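(* Let $m\ge 2$, $n\ge1$, $d\ge1$ be integers, let $\mathbf{X}=S^{n-1}\times\cdots\times S^{n-1}$ ($m$ factors) $=\{(\mathbf{x}_1,\dots,\mathbf{x}_m)\in(\mathbb{R}^n)^m:\ 1-\|\mathbf{x}_j\|^2=0,\ j=1,\dots,m\}$, and let $q\in\mathbb{R}[\mathbf{x}_1,\dots,\mathbf{x}_m]$ have degree at most $d$, with $q_{\min}$, $q_{\max}$ its minimum and maximum on $\mathbf{X}$. Then for every integer $t\ge 2nd\sqrt{d}$, $$q_{\min}-\mathrm{lb}(q,\mathcal{T}(\mathbf{X}))_{mt}\le\frac{C_{\mathbf{X}}(n,d,m)}{t^2}(q_{\max}-q_{\min}),\qquad C_{\mathbf{X}}(n,d,m):=m\,2^m n^2d^3\binom{d+m}{m}\gamma(S^{n-1})_d^m.$$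
   Context: $\|\cdot\|$ is the Euclidean norm; $\Sigma$ denotes sums of squares of real polynomials. For an integer $s$, $\mathcal{T}(\mathbf{X})_{2s}:=\{\sigma+\sum_{j=1}^m h_j(1-\|\mathbf{x}_j\|^2):\ \sigma\in\Sigma[\mathbf{x}_1,\dots,\mathbf{x}_m],\ \deg\sigma\le 2s,\ h_j\in\mathbb{R}[\mathbf{x}_1,\dots,\mathbf{x}_m],\ \deg h_j\le 2s-2\}$ and $\mathrm{lb}(q,\mathcal{T}(\mathbf{X}))_s:=\sup\{\tau\in\mathbb{R}: q-\tau\in\mathcal{T}(\mathbf{X})_{2s}\}$. Harmonic constant: equip $S^{n-1}$ with the uniform probability measure, let $H_k$ be the spherical harmonics of degree $k$; every $p\in\mathbb{R}[\mathbf{x}]_d$ satisfies $p=\sum_{k=0}^dp_k$ on $S^{n-1}$ with $p_k\in H_k$; with $\|p\|_{S^{n-1}}=\max_{S^{n-1}}|p|$, $\gamma(S^{n-1})_d:=\max_{p\in\mathbb{R}[\mathbf{x}]_d,\,p\not\equiv0\text{ on }S^{n-1}}\max_{0\le k\le d}\|p_k\|_{S^{n-1}}/\|p\|_{S^{n-1}}$. *)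

(* Defs.v *)
From HB Require Import structures.
From mathcomp Require Import all_boot all_order all_algebra.
From mathcomp Require Import mpoly.
From mathcomp Require Import boolp classical_sets reals.
Set Implicit Arguments. Unset Strict Implicit. Unset Printing Implicit Defensive.
Import Order.TTheory GRing.Theory Num.Theory.
Local Open Scope ring_scope.
Local Open Scope classical_set_scope.

(* total degree of p is at most d  (msize p = 1 + deg p, msize 0 = 0) *)
Definition deg_le (R : realType) (N : nat) (p : {mpoly R[N]}) (d : nat) : Prop :=
  (msize p <= d.+1)%N.

Definition is_sos (R : realType) (N : nat) (s : {mpoly R[N]}) : Prop :=
  exists l : seq {mpoly R[N]}, s = \sum_(f <- l) f ^+ 2.

(* Variables of R[x_1,...,x_m] (x_j in R^n) are indexed by 'I_(m*n):
   the variable (x_j)_i is 'X_(mxvec_index j i).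
   A point of (R^n)^m is a matrix P : 'M_(m,n) whose row j is x_j. *)
Definition evalX (R : realType) (m n : nat) (q : {mpoly R[m * n]})
  (P : 'M[R]_(m, n)) : R :=
  q.@[fun k : 'I_(m * n) => mxvec P 0 k].

Definition prod_spheres (R : realType) (m n : nat) : set 'M[R]_(m, n) :=
  [set P | forall j : 'I_m, 1 - \sum_(i < n) P j i ^+ 2 = 0].

Definition gsph (R : realType) (m n : nat) (j : 'I_m) : {mpoly R[m * n]} :=
  1 - \sum_(i < n) 'X_(mxvec_index j i) ^+ 2.

Definition trunc_qmod (R : realType) (m n s : nat) : set {mpoly R[m * n]} :=
  [set f | exists (sigma : {mpoly R[m * n]}) (h : 'I_m -> {mpoly R[m * n]}),
      [/\ is_sos sigma, deg_le sigma (2 * s),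
          (forall j, deg_le (h j) (2 * s - 2)) &
          f = sigma + \sum_(j < m) h j * @gsph R m n j]].

Definition lbT (R : realType) (m n : nat) (q : {mpoly R[m * n]}) (s : nat) : R :=
  sup [set tau : R | @trunc_qmod R m n s (q - tau%:MP)].

Definition sphere (R : realType) (n : nat) : set ('I_n -> R) :=
  [set v | \sum_(i < n) v i ^+ 2 = 1].

Definition laplacian (R : realType) (n : nat) (p : {mpoly R[n]}) : {mpoly R[n]} :=
  \sum_(i < n) mderiv i (mderiv i p).

Definition harmonic_homog (R : realType) (n k : nat) (p : {mpoly R[n]}) : Prop :=
  p \is k.-homog /\ @laplacian R n p = 0.

Definition sph_norm (R : realType) (n : nat) (p : {mpoly R[n]}) : R :=
  sup [set `|p.@[v]| | v in @sphere R n].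

(* gamma(S^{n-1})_d: max over p of degree <= d, not identically zero on the
   sphere, and over k <= d, of ||p_k|| / ||p||, where p = sum_k p_k on the
   sphere with p_k in H_k (this decomposition is unique). *)
Definition gammaS (R : realType) (n d : nat) : R :=
  sup [set r : R | exists p : {mpoly R[n]},
     [/\ deg_le p d,
         (exists2 v, @sphere R n v & p.@[v] != 0) &
         exists pk : nat -> {mpoly R[n]},
           [/\ (forall k, (k <= d)%N -> @harmonic_homog R n k (pk k)),
               (forall v, @sphere R n v -> p.@[v] = \sum_(k < d.+1) (pk k).@[v]) &
               exists2 k, (k <= d)%N & r = @sph_norm R n (pk k) / @sph_norm R n p]]].

Definition CX (R : realType) (n d m : nat) : R :=
  m%:R * 2%:R ^+ m * n%:R ^+ 2 * d%:R ^+ 3 * ('C(d + m, m))%:R * @gammaS R n d ^+ m.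

(* Main.v *)
(* Let K be the operator with kernel prod_j f(<x_j, y_j>)^2, deg f <= t, normalized so that K 1 = 1.
   By Funk-Hecke it is diagonal on products of spherical harmonics, and positivity of
   1 - Re z^k <= k^2 (1 - Re z), |z| <= 1, applied to the harmonics Re (x_0 + i x_1)^k gives
   1 - lambda_k <= k^2 (1 - lambda_1); choosing f by a trial vector for the Gegenbauer Jacobi
   matrix makes 1 - lambda_1 = O(n^2 / t^2).  Hence K^-1 q is close to q, with an error controlled
   by the harmonic components of q, each bounded through gamma one sphere at a time; so
   K^-1 q - q_min + eps >= 0 on X, and q - q_min + eps = K (K^-1 q - q_min + eps) is an
   average of squares.  The average is made a finite sum by a positive spherical quadrature,
   the radial projection of a product Gauss-Hermite rule, whose only needed property is the Gaussian
   integration by parts E [y_l g] = E [d_l g].  All identities on the spheres are tracked as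
   congruences modulo the ideal, with degree bounds on the cofactors. *)
Require Import Defs.
From HB Require Import structures.
From mathcomp Require Import all_boot all_order all_algebra.
From mathcomp Require Import mpoly ring lra zify complex.
From mathcomp Require Import boolp classical_sets reals.
Set Implicit Arguments. Unset Strict Implicit. Unset Printing Implicit Defensive.
Import Order.TTheory GRing.Theory Num.Theory.
Local Open Scope ring_scope.
(** * Gauss-Hermite quadrature *)

Section MomentFunctional.
Variables (R : realType) (mu : nat -> R).

(** No integral occurs: an average is either a linear functional on polynomials given by its moments
    or a finite nonnegative sum. Membership in the truncated module also bounds the cofactors h_j,
    so equality of functions on X is not enough; Funk-Hecke and the harmonic decomposition are
    therefore proved as polynomial identities, with explicit powers of |x_j|^2, before any
    restriction to the spheres. The squared kernel has degree 2t in each x_j, whence the level mt.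
    On one sphere 1 - lambda_k <= k^2 e with e = (5/2) n^2 / t^2, and t >= 2nd sqrt(d) keeps d^2 e
    at most 5/8, so that K can be inverted on the components of q. There are at most binomial(d+m,
    m) of these, each bounded by gamma^m times the sup norm of q, which is half of q_max - q_min
    once q is centred. The numerical constants are absorbed by m 2^m >= 8. *)

Definition mfun (g : {poly R}) : R := \sum_(i < size g) g`_i * mu i.

Lemma mfunwE N (g : {poly R}) : (size g <= N)%N ->
  mfun g = \sum_(i < N) g`_i * mu i.
Proof.
move=> h; rewrite /mfun (big_ord_widen N (fun i => g`_i * mu i) h) big_mkcond.
apply: eq_bigr => i _; case: ltnP => // hi; by rewrite nth_default ?mul0r.
Qed.

Fact mfun_is_linear : linear_for *%R mfun.
Proof.
move=> a p q; pose N := maxn (size p) (size q).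
rewrite (@mfunwE N) ?(@mfunwE N p) ?(@mfunwE N q) ?leq_maxl ?leq_maxr //; last first.
  by rewrite (leq_trans (size_polyD _ _)) // geq_max leq_maxr andbT (leq_trans (size_scale_leq _ _)) ?leq_maxl.
by rewrite mulr_sumr -big_split; apply: eq_bigr => i _; rewrite coefD coefZ /= mulrDl mulrA.
Qed.
HB.instance Definition _ :=
  GRing.isLinear.Build R {poly R} R *%R mfun mfun_is_linear.

Lemma mfunXn k : mfun 'X^k = mu k.
Proof.
rewrite /mfun size_polyXn (bigD1 ord_max) //= big1 ?addr0 ?coefXn ?eqxx ?mul1r //.
by move=> i /negbTE hi; rewrite coefXn -[k in (_ == k)%N]/(nat_of_ord (ord_max : 'I_k.+1)) (inj_eq val_inj) hi mul0r.
Qed.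

Lemma mfunZ a g : mfun (a *: g) = a * mfun g.
Proof. exact: linearZ. Qed.
End MomentFunctional.

Section Hermite.
Variable R : realType.

Lemma leq_size_deriv (p : {poly R}) : (size p^`() <= size p)%N.
Proof.
have [->|p0] := eqVneq p 0; first by rewrite linear0.
by rewrite ltnW // lt_size_deriv.
Qed.

(** Moments of the standard Gaussian; the recursion is integration by parts on monomials, so
    [gauss_ibp] follows by linearity. *)
Fixpoint gmom (k : nat) : R :=
  match k with 0 => 1 | 1 => 0 | k'.+2 => k'.+1%:R * gmom k' end.

Local Notation E := (mfun gmom).

Lemma gauss_ibp (g : {poly R}) : E ('X * g) = E g^`().
Proof.
rewrite -[g]coefK poly_def mulr_sumr raddf_sum /= linear_sum [RHS]linear_sum.
apply: eq_bigr => i _ /=; rewrite derivZ derivXn -scalerAr -exprS !mfunZ mfunXn; congr (_ * _).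
case: (nat_of_ord i) => [|[|j]] /=; rewrite ?mulr0n ?raddf0 //.
  by rewrite raddfMn /= mfunXn /= mulr1n mul1r.
by rewrite raddfMn /= mfunXn /= mulr_natl.
Qed.

(** Probabilists' Hermite polynomials. The operator X - d/dX is adjoint to d/dX under [E], so
    orthogonality is integration by parts iterated k times. *)
Fixpoint hermite (k : nat) : {poly R} :=
  if k is k'.+1 then 'X * hermite k' - (hermite k')^`() else 1.

Lemma hermite_orthoS k q : E (hermite k.+1 * q) = E (hermite k * q^`()).
Proof.
rewrite /= mulrBl raddfB /= -mulrA gauss_ibp derivM raddfD /=; ring.
Qed.

Lemma hermite_ortho k q : E (hermite k * q) = E q^`(k).
Proof.
elim: k q => [|k IH] q; first by rewrite mul1r derivn0.
by rewrite hermite_orthoS IH derivSn.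
Qed.

Lemma hermite_size_monic k : size (hermite k) = k.+1 /\ hermite k \is monic.
Proof.
elim: k => [|k [IHs IHm]] /=; first by rewrite size_poly1 monic1.
have sX : size ('X * hermite k) = k.+2.
  by rewrite mulrC size_mulX ?IHs // -size_poly_eq0 IHs.
have hl : (size (- (hermite k)^`())%R < size ('X * hermite k)%R)%N.
  rewrite size_polyN sX; apply: leq_ltn_trans (_ : k.+1 < k.+2)%N => //.
  by rewrite -IHs leq_size_deriv.
rewrite size_polyDl // sX; split=> //.
by rewrite monicE lead_coefDl // lead_coef_monicM ?monicX // -monicE.
Qed.

Lemma size_hermite k : size (hermite k) = k.+1.
Proof. by case: (hermite_size_monic k). Qed.
Lemma hermite_monic k : hermite k \is monic.
Proof. by case: (hermite_size_monic k). Qed.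

Lemma hermite_ortho0 k (q : {poly R}) : (size q <= k)%N -> E (hermite k * q) = 0.
Proof.
move=> h; rewrite hermite_ortho; suff -> : q^`(k) = 0 by rewrite raddf0.
apply/polyP => i; rewrite coef_derivn coef0 nth_default ?mul0rn //.
by rewrite (leq_trans h) // leq_addr.
Qed.

Lemma hermite_norm k : E (hermite k ^+ 2) = k`!%:R.
Proof.
rewrite expr2 hermite_ortho.
suff -> : (hermite k)^`(k) = (k`!%:R)%:P.
  by rewrite -[_%:P]mulr1 mul_polyC mfunZ -(expr0 'X) mfunXn mulr1.
apply/polyP => i; rewrite coef_derivn coefC; case: i => [|i].
  have := hermite_monic k; rewrite monicE lead_coefE size_hermite /= addn0 => /eqP ->.
  by rewrite ffactnn.
by rewrite nth_default ?mul0rn // size_hermite addnS ltnS leq_addr.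
Qed.

(** Positivity without an integral: the leading Hermite component is orthogonal to the remainder of
    lower degree and has square norm k!; the remainder is handled by induction. *)
Lemma gauss_pos (g : {poly R}) : g != 0 -> 0 < E (g ^+ 2).
Proof.
elim: {g}_.+1 {-2}g (ltnSn (size g)) => // N IH g hN g0.
case hs: (size g) => [|k]; first by move/eqP: hs; rewrite size_poly_eq0 (negbTE g0).
pose c := lead_coef g; pose g1 := g - c *: hermite k.
have c0 : c != 0 by rewrite lead_coef_eq0.
have sg1 : (size g1 <= k)%N.
  apply/leq_sizeP => j; rewrite leq_eqVlt => /orP[/eqP <-|hj].
    have := hermite_monic k; rewrite coefB coefZ monicE lead_coefE size_hermite /= => /eqP ->.
    by rewrite /c lead_coefE hs /= mulr1 subrr.
  by rewrite coefB coefZ !nth_default ?size_hermite ?hs // mulr0 subr0.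
have -> : g ^+ 2 = (c ^+ 2) *: (hermite k ^+ 2) + (c *+ 2) *: (hermite k * g1) + g1 ^+ 2.
  rewrite -[g in LHS](subrK (c *: hermite k)) -/g1 -!mul_polyC rmorphXn /= rmorphMn /=; ring.
rewrite !raddfD /= !mfunZ hermite_norm hermite_ortho0 // mulr0 addr0.
have : 0 < c ^+ 2 * k`!%:R :> R by rewrite mulr_gt0 ?exprn_even_gt0 ?ltr0n ?fact_gt0.
have [->|g10] := eqVneq g1 0; first by rewrite expr0n raddf0 addr0.
by move=> h; rewrite addr_gt0 // IH // (leq_ltn_trans sg1) // -hs -ltnS.
Qed.

Lemma gauss_ge0 (g : {poly R}) : 0 <= E (g ^+ 2).
Proof.
have [->|h] := eqVneq g 0; first by rewrite expr0n raddf0.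
by rewrite ltW // gauss_pos.
Qed.

(* The cofactor r of such a factor has degree < k, so E (hermite k * r) = 0. *)
Lemma hermite_no_quadratic k a b (r : {poly R}) :
  hermite k = (('X - a%:P) ^+ 2 + (b ^+ 2)%:P) * r -> False.
Proof.
move=> h; have h0 : hermite k != 0 by rewrite monic_neq0 ?hermite_monic.
have r0 : r != 0 by apply: contraNneq h0 => r0; rewrite h r0 mulr0.
have hq : size (('X - a%:P) ^+ 2 + (b ^+ 2)%:P) = 3%N.
  rewrite size_polyDl size_exp_XsubC // ltnS (leq_trans (size_polyC_leq1 _)) //.
have q0 : ('X - a%:P) ^+ 2 + (b ^+ 2)%:P != 0 by rewrite -size_poly_eq0 hq.
have sr : (size r <= k)%N.
  move: (congr1 (fun p : {poly R} => size p) h); rewrite size_hermite size_mul // hq !addSn /= => -[->]; by rewrite add0n leqnSn.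
have := hermite_ortho0 sr; rewrite h.
have -> : (('X - a%:P) ^+ 2 + (b ^+ 2)%:P) * r * r = (('X - a%:P) * r) ^+ 2 + b^+2 *: (r ^+ 2).
  rewrite -!mul_polyC; ring.
rewrite raddfD /= mfunZ => /eqP; rewrite gt_eqF // ltr_wpDr //.
  by rewrite mulr_ge0 ?sqr_ge0 ?gauss_ge0.
by rewrite gauss_pos // mulf_neq0 // polyXsubC_eq0.
Qed.

(** A nonreal root a + ib, or a double real root a with b = 0, would make (X - a)^2 + b^2 a factor,
    which [hermite_no_quadratic] forbids. *)
Lemma hermite_split k : exists2 s : seq R, uniq s & hermite k = \prod_(z <- s) ('X - z%:P).
Proof.
have [s hs] := closed_field_poly_normal (map_poly (real_complex R) (hermite k)).
have hm : map_poly (real_complex R) (hermite k) \is monic by rewrite map_monic hermite_monic.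
rewrite (monicP hm) scale1r in hs.
have hre c : c \in s -> c = real_complex R (complex.Re c).
  move=> cs; case: c cs => a b cs; rewrite [complex.Re _]/=.
  have [->//|b0] := eqVneq b 0; exfalso.
  pose Q : {poly R} := ('X - a%:P) ^+ 2 + (b ^+ 2)%:P.
  have hq : size Q = 3%N.
    by rewrite size_polyDl size_exp_XsubC // ltnS (leq_trans (size_polyC_leq1 _)).
  suff : hermite k %% Q = 0.
    move=> h; apply: (@hermite_no_quadratic k a b (hermite k %/ Q)).
    by rewrite mulrC {1}(divp_eq (hermite k) Q) h addr0.
  set r := hermite k %% Q.
  have sr : (size r <= 2)%N.
    have : (size r < size Q)%N by rewrite ltn_modp -size_poly_eq0 hq.
    by rewrite hq.
  have hc : (map_poly (real_complex R) r).[(a +i* b)%C] = 0.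
    have : root (map_poly (real_complex R) (hermite k)) (a +i* b)%C.
      by rewrite hs root_prod_XsubC.
    rewrite /root (divp_eq (hermite k) Q) rmorphD rmorphM /= !hornerE.
    have -> : (map_poly (real_complex R) Q).[(a +i* b)%C] = 0.
      rewrite /Q rmorphD rmorphXn /= rmorphB /= map_polyX !map_polyC /= !hornerE.
      by rewrite !expr2; simpc; apply/eqP; rewrite eq_complex /=; apply/andP; split; apply/eqP; ring.
    by rewrite mulr0 add0r => /eqP.
  have re : r = (r`_0)%:P + r`_1 *: 'X.
    apply/polyP => i; rewrite coefD coefC coefZ coefX; case: i => [|[|i]] /=; rewrite ?mulr0 ?mulr1 ?addr0 ?add0r //.
    by rewrite nth_default // (leq_trans sr).
  move: hc; rewrite re rmorphD /= map_polyZ /= map_polyX map_polyC /= !hornerE.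
  simpc => -[h1 h2].
  have r1 : r`_1 = 0 by move/eqP: h2; rewrite mulf_eq0 (negbTE b0) orbF => /eqP.
  by rewrite r1 mul0r addr0 in h1; rewrite r1 h1 scale0r addr0.
have hP : hermite k = \prod_(z <- map (@complex.Re R) s) ('X - z%:P).
  apply: (@map_poly_inj _ _ (real_complex R)); rewrite hs rmorph_prod /= big_map.
  rewrite big_seq [RHS]big_seq; apply: eq_bigr => c cs.
  by rewrite rmorphB /= map_polyX map_polyC /= -hre.
exists (map (@complex.Re R) s) => //.
move: hP; set l := map _ s => hP; apply/negPn/negP => /(uniqPn 0)[i [j [ij js e]]].
have [l1 [l2 [l3 el]]] : exists l1 l2 l3 : seq R, l = l1 ++ (nth 0 l i :: l2) ++ (nth 0 l i :: l3).
  exists (take i l), (take (j - i.+1) (drop i.+1 l)), (drop j.+1 l).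
  rewrite -{1}(cat_take_drop i l) (drop_nth 0) ?(ltn_trans ij) //=; congr (_ ++ _ :: _).
  rewrite -{1}(cat_take_drop (j - i.+1) (drop i.+1 l)); congr (_ ++ _).
  by rewrite drop_drop subnK // e -drop_nth.
apply: (@hermite_no_quadratic k (nth 0 l i) 0 (\prod_(z <- l1 ++ l2 ++ l3) ('X - z%:P))).
rewrite hP [in LHS]el !(big_cat, big_cons) /= expr0n /=.
move: (\prod_(_ <- l1) _) (\prod_(_ <- l2) _) (\prod_(_ <- l3) _) => x y t.
rewrite polyC0; ring.
Qed.

(** Gauss quadrature at the roots of the N-th Hermite polynomial: division by it leaves a remainder
    recovered by Lagrange interpolation and a multiple of it with mean 0, hence exactness up to
    degree 2N - 1. Integration by parts for [E] then passes to the nodes. *)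
Lemma gauss_quadrature N : (0 < N)%N -> exists (I : finType) (w z : I -> R),
  [/\ forall i, 0 <= w i, \sum_i w i = 1 &
   forall g : {poly R}, (size g < N)%N ->
     \sum_i w i * (z i * g.[z i]) = \sum_i w i * g^`().[z i]].
Proof.
move=> N0; have [s us hs] := hermite_split N.
have ss : size s = N.
  by apply: succn_inj; rewrite -(size_prod_XsubC s id) -hs size_hermite.
pose z (i : 'I_N) := s`_i.
have zinj i j : z i = z j -> i = j.
  by move=> /eqP; rewrite nth_uniq ?ss // => /eqP /val_inj.
pose l i : {poly R} := (\prod_(j < N | j != i) (z i - z j))^-1 *: \prod_(j < N | j != i) ('X - (z j)%:P).
have hN : hermite N = \prod_(j < N) ('X - (z j)%:P).
  by rewrite hs (big_nth 0) ss big_mkord.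
have ll i : (l i).[z i] = 1.
  rewrite /l hornerZ horner_prod.
  under [X in _ * X]eq_bigr do rewrite hornerXsubC.
  rewrite mulVf //; apply/prodf_neq0 => j hj; rewrite subr_eq0.
  by apply: contra hj => /eqP /zinj ->.
have lj i j : j != i -> (l i).[z j] = 0.
  move=> ji; rewrite /l hornerZ horner_prod.
  under [X in _ * X]eq_bigr do rewrite hornerXsubC.
  by rewrite [X in _ * X](bigD1 j) //= subrr mul0r mulr0.
have sl i : (size (l i) <= N)%N.
  rewrite /l (leq_trans (size_scale_leq _ _)) // (leq_trans (size_prod_leq _ _)) //.
  under eq_bigr do rewrite size_XsubC.
  by rewrite sum_nat_const (cardC1 i) card_ord; case: (N) N0 => // N' _ /=; lia.
have root0 (g : {poly R}) : (size g <= N)%N -> (forall i, g.[z i] = 0) -> g = 0.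
  move=> sg hg; apply: (@roots_geq_poly_eq0 _ _ s) => //; last by rewrite ss.
  apply/allP => x /(nthP 0)[i hi <-]; rewrite ss in hi.
  by rewrite /root; apply/eqP; apply: (hg (Ordinal hi)).
have Hz i : (hermite N).[z i] = 0.
  by rewrite hN horner_prod (bigD1 i) //= !hornerE subrr mul0r.
have exact (g : {poly R}) : (size g <= N + N)%N -> E g = \sum_i E (l i) * g.[z i].
  move=> sg; set r := g %% hermite N.
  have H0 : hermite N != 0 by rewrite monic_neq0 ?hermite_monic.
  have sr : (size r <= N)%N by rewrite -ltnS -(size_hermite N) ltn_modp.
  have gz i : g.[z i] = r.[z i].
    by rewrite (divp_eq g (hermite N)) hornerD hornerM Hz mulr0 add0r.
  have re : r = \sum_i r.[z i] *: l i.
    apply/eqP; rewrite -subr_eq0; apply/eqP/root0.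
      rewrite (leq_trans (size_polyD _ _)) // geq_max sr size_polyN.
      rewrite (leq_trans (size_sum _ _ _)) //; apply/bigmax_leqP => i _.
      by rewrite (leq_trans (size_scale_leq _ _)).
    move=> i; rewrite hornerD hornerN horner_sum (bigD1 i) //= hornerZ ll mulr1 big1 ?addr0 ?subrr //.
    by move=> j ji; rewrite hornerZ lj ?mulr0 // eq_sym.
  rewrite {1}(divp_eq g (hermite N)) raddfD /= mulrC hermite_ortho0 ?add0r; last first.
    by rewrite size_divp // size_hermite leq_subLR.
  rewrite -/r [in LHS]re raddf_sum /=; apply: eq_bigr => i _.
  by rewrite mfunZ gz mulrC.
exists 'I_N, (fun i => E (l i)), z; split.
(* By exactness, as l_i and its square agree at all nodes. *)
- move=> i; suff -> : E (l i) = E (l i ^+ 2) by apply: gauss_ge0.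
  rewrite [RHS]exact; last first.
    by rewrite (leq_trans (size_polyMleq _ _)) // -subn1 leq_subLR (leq_trans (leq_add (sl i) (sl i))) // leq_addl.
  rewrite (bigD1 i) //= horner_exp ll expr1n mulr1 big1 ?addr0 // => j ji.
  by rewrite horner_exp lj // expr0n mulr0.
- have := @exact 1; rewrite size_poly1 addn_gt0 N0 -(expr0 'X) mfunXn => /(_ isT) /= ->.
  by apply: eq_bigr => i _; rewrite expr0 hornerE mulr1.
- move=> g sg; have hs1 : (size ('X * g)%R <= N + N)%N.
    by rewrite (leq_trans (size_polyMleq _ _)) // size_polyX (leq_trans sg) // leq_addr.
  have hs2 : (size g^`() <= N + N)%N.
    by rewrite (leq_trans (leq_size_deriv _)) // (leq_trans (ltnW sg)) // leq_addr.
  rewrite -(exact _ hs2) -gauss_ibp (exact _ hs1).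
  by apply: eq_bigr => i _; rewrite !hornerE.
Qed.
End Hermite.

(** * Gaussian designs and spherical designs *)

Section GaussDesign.
Variables (R : realType) (n : nat).

Definition gauss_design N (I : finType) (c : I -> R) (y : I -> 'I_n -> R) : Prop :=
  [/\ forall i, 0 <= c i, \sum_i c i = 1 &
   forall (l : 'I_n) (g : {mpoly R[n]}), (msize g <= N)%N ->
     \sum_i c i * (y i l * g.@[y i]) = \sum_i c i * (g^`M(l)).@[y i]].

(** On a monomial the product rule factors over the coordinates, and the two sides differ only in
    coordinate l, where the one-dimensional rule applies. *)
Lemma gauss_design_exists N :
  exists (I : finType) (c : I -> R) (y : I -> 'I_n -> R), gauss_design N c y.
Proof.
have [J [w [z [w0 w1 wibp]]]] := @gauss_quadrature R N.+1 isT.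
exists {ffun 'I_n -> J}, (fun f : {ffun 'I_n -> J} => \prod_l w (f l)), (fun (f : {ffun 'I_n -> J}) l => z (f l)); split.
- by move=> f; apply: prodr_ge0.
- rewrite -(bigA_distr_bigA (fun _ => w)) big1 // => l _; exact: w1.
move=> l g hg.
have hX m : m \in msupp g ->
    \sum_(f : {ffun 'I_n -> J}) (\prod_k w (f k)) * (z (f l) * 'X_[m].@[fun k => z (f k)])
    = \sum_(f : {ffun 'I_n -> J}) (\prod_k w (f k)) * (('X_[m] : {mpoly R[n]})^`M(l)).@[fun k => z (f k)].
  move=> hm; have hml : (m l < N)%N.
    have := leq_trans (msize_mdeg_lt hm) hg; rewrite mdegE (bigD1 l) //=.
    by apply: leq_trans; rewrite ltnS leq_addr.
  have e1 a (f : {ffun 'I_n -> J}) : (\prod_k w (f k)) * \prod_k z (f k) ^+ a k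
       = \prod_k (w (f k) * z (f k) ^+ a k) by rewrite -big_split.
  under [RHS]eq_bigr do rewrite mderivX mevalZ mevalX mulrCA e1.
  under [LHS]eq_bigr => f _.
    rewrite mevalX (_ : z (f l) * _ = \prod_k z (f k) ^+ (m + U_(l))%MM k); last first.
      rewrite [RHS](eq_bigr (fun k => z (f k) ^+ (l == k) * z (f k) ^+ m k)); last first.
        by move=> k _; rewrite mnmDE mnm1E addnC exprD.
      rewrite big_split; congr (_ * _); rewrite (bigD1 l) //= eqxx big1 ?mulr1 // => k.
      by rewrite eq_sym => /negbTE ->.
    rewrite e1; over.
  rewrite -mulr_sumr -!(bigA_distr_bigA (fun k j => w j * z j ^+ _)).
  rewrite (bigD1 l) // [X in _ = _ * X](bigD1 l) //= mulrA; congr (_ * _).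
    rewrite mnmDE mnmBE mnm1E eqxx addn1 subn1.
    have := wibp 'X^(m l); rewrite size_polyXn ltnS hml => /(_ isT).
    rewrite (eq_bigr (fun j => w j * z j ^+ (m l).+1)) => [->|j _]; last by rewrite hornerXn -exprS.
    rewrite mulr_sumr; apply: eq_bigr => j _.
    by rewrite derivXn hornerMn hornerXn mulrnAr mulr_natl.
  apply: eq_bigr => k kl; apply: eq_bigr => j _.
  by rewrite mnmDE mnmBE mnm1E eq_sym (negbTE kl) addn0 subn0.
rewrite [g in LHS]mpolyE [g in RHS]mpolyE linear_sum /=.
under eq_bigr do rewrite raddf_sum !mulr_sumr.
under [RHS]eq_bigr do rewrite raddf_sum mulr_sumr.
rewrite exchange_big [RHS]exchange_big /= big_seq [RHS]big_seq; apply: eq_bigr => m hm.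
under eq_bigr => f _ do rewrite mevalZ !(mulrCA _ g@_m).
under [RHS]eq_bigr => f _ do rewrite mderivZ mevalZ (mulrCA _ g@_m).
by rewrite -!mulr_sumr hX.
Qed.
End GaussDesign.

Section Euler.
Variables (R : realType) (n : nat).

Lemma msizeM_leq a b (p q : {mpoly R[n]}) : (msize p <= a.+1)%N -> (msize q <= b.+1)%N ->
  (msize (p * q)%R <= (a + b).+1)%N.
Proof.
have [->|p0] := eqVneq p 0; first by rewrite mul0r msize0.
have [->|q0] := eqVneq q 0; first by rewrite mulr0 msize0.
rewrite msizeM // (mpolySpred _ p0) (mpolySpred _ q0) !ltnS addnS /= => h1 h2.
by rewrite ltnS leq_add.
Qed.

Lemma msizeXM_leq (l : 'I_n) (p : {mpoly R[n]}) : (msize ('X_l * p)%R <= (msize p).+1)%N.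
Proof.
have [->|p0] := eqVneq p 0; first by rewrite mulr0 msize0.
rewrite [in X in (_ <= X)%N](mpolySpred _ p0); apply: (@msizeM_leq 1 (msize p).-1); first by rewrite msizeX mdeg1.
by rewrite -mpolySpred.
Qed.

Lemma mderivXU (a l : 'I_n) : ('X_a : {mpoly R[n]})^`M(l) = (a == l)%:R.
Proof.
rewrite mderivX mnm1E; case: eqVneq => [->|]; last by rewrite scale0r.
rewrite scale1r -mpolyX0; congr mpolyX; apply/mnmP => i.
by rewrite mnmBE mnm0E subnn.
Qed.

Lemma euler_homog k (g : {mpoly R[n]}) : g \is k.-homog ->
  \sum_l 'X_l * g^`M(l) = k%:R *: g.
Proof.
move=> hg; rewrite {2}[g]mpolyE scaler_sumr.
under eq_bigr => l _ do rewrite {1}[g]mpolyE linear_sum /= mulr_sumr.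
rewrite exchange_big /= big_seq [RHS]big_seq; apply: eq_bigr => m hm.
under eq_bigr do rewrite mderivZ mderivX scalerA -scalerAr.
have <- : mdeg m = k := dhomog_mf hg hm.
rewrite mdegE natr_sum scaler_suml; apply: eq_bigr => l _.
have [->|ml] := eqVneq (m l) 0%N; first by rewrite mulr0 !scale0r.
by rewrite -mpolyXD addmC submK ?lep1mP // scalerA mulrC.
Qed.

Lemma dhomog_mderiv k (l : 'I_n) (g : {mpoly R[n]}) : g \is k.-homog -> g^`M(l) \is k.-1.-homog.
Proof.
move=> hg; apply/dhomogP => m; rewrite mcoeff_msupp mcoeff_deriv => hm.
have : (m + U_(l))%MM \in msupp g by rewrite mcoeff_msupp; apply: contraNneq hm => ->; rewrite mul0rn.
by move/(dhomog_mf hg) => /= <-; rewrite mdegD mdeg1 addn1.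
Qed.

Lemma dhomog_msize_leq k (g : {mpoly R[n]}) : g \is k.-homog -> (msize g <= k.+1)%N.
Proof.
move=> hg; rewrite msizeE; apply/bigmax_leqP_seq => m hm _.
by rewrite (dhomog_mf hg hm).
Qed.

Lemma harmonic_mderiv k (l : 'I_n) (h : {mpoly R[n]}) :
  harmonic_homog k h -> harmonic_homog k.-1 h^`M(l).
Proof.
case=> hh hl; split; first exact: dhomog_mderiv.
rewrite /laplacian; under eq_bigr do rewrite (mderiv_comm l) (mderiv_comm l).
by rewrite -linear_sum -/(laplacian h) hl linear0.
Qed.

Lemma meval_homogZ k (g : {mpoly R[n]}) r v : g \is k.-homog ->
  g.@[fun l => r * v l] = r ^+ k * g.@[v].
Proof.
move=> hg; rewrite !mevalE mulr_sumr big_seq [RHS]big_seq; apply: eq_bigr => m hm.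
under eq_bigr do rewrite exprMn.
by rewrite big_split /= prodrXr -mdegE (dhomog_mf hg hm) mulrCA.
Qed.
End Euler.

(** * The Funk-Hecke formula for Gaussian designs *)

Section FunkHecke.
Variable R : realType.

(* The Gaussian expectation of h(y) <x, y>^s for h harmonic of degree k is
   [gcoef s k] * |x|^(s - k) * h(x). *)
Fixpoint gcoef (s k : nat) : R :=
  match s with
  | 0 => (k == 0)%:R
  | 1 => (k == 1)%:R
  | (s'.+1 as s1).+1 => k%:R * gcoef s1 k.-1 + s1%:R * gcoef s' k
  end.

Arguments gcoef : simpl never.

Lemma gcoefSS s k : gcoef s.+2 k = k%:R * gcoef s.+1 k.-1 + s.+1%:R * gcoef s k.
Proof. by []. Qed.

Lemma gcoef_lt s k : (s < k)%N -> gcoef s k = 0.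
Proof.
elim/ltn_ind: s k => -[|[|s]] IH k hk; rewrite ?gcoefSS //=.
- by case: k hk.
- by case: k hk => [|[]].
- by rewrite !IH ?mulr0 ?addr0 //; case: k hk => // k /ltnW /ltnW.
Qed.

Lemma gcoef_odd s k : odd (s + k) -> gcoef s k = 0.
Proof.
elim/ltn_ind: s k => -[|[|s]] IH k hk; rewrite ?gcoefSS /=.
- by case: k hk.
- by case: k hk => [|[]].
- rewrite [gcoef s k]IH ?mulr0 ?addr0 //; last by move: hk; rewrite !addSn /= negbK.
  case: k hk => [|k] hk; first by rewrite mul0r.
  by rewrite /= IH ?mulr0 //; move: hk; rewrite !addSn addnS /= !negbK.
Qed.

Lemma gcoef_diag k : gcoef k k = k`!%:R.
Proof.
elim: k => [|[|k] IH] //; rewrite gcoefSS IH gcoef_lt ?mulr0 ?addr0 //.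
by rewrite -natrM -factS.
Qed.

(** The Gaussian moment of |y|^(2b) in dimension n, which is the ratio of the Gaussian to the
    spherical mean of a homogeneous polynomial of degree 2b. *)
Definition rho (n b : nat) : R := \prod_(i < b) (n + i.*2)%:R.

Lemma rho_gt0 n b : (0 < n)%N -> 0 < rho n b.
Proof. by move=> n0; apply: prodr_gt0 => i _; rewrite ltr0n addn_gt0 n0. Qed.

(** The spherical analogue of [gcoef]: [mfun (scoef R n k) g] is the eigenvalue of the kernel g(<x,
    u>) on H_k, and k = 0 gives the moments of one coordinate. For odd k + s the numerator is 0, so
    rounding the half is harmless. *)
Definition scoef (n k s : nat) : R := gcoef s k / rho n (k + s)./2.

Variables (n N : nat) (I : finType) (c : I -> R) (y : I -> 'I_n -> R).
Hypothesis Dy : gauss_design N c y.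
Variables (M : nat) (x : 'I_n -> {mpoly R[M]}).

(** The [x l] are polynomials in any number of variables, so that the formulas below are polynomial
    identities, not yet using |x|^2 = 1. *)
Definition linf (v : 'I_n -> R) : {mpoly R[M]} := \sum_l v l *: x l.
Definition sqx : {mpoly R[M]} := \sum_l x l ^+ 2.
Local Notation X := [tuple x l | l < n].

Definition gint s (g : {mpoly R[n]}) : {mpoly R[M]} :=
  \sum_i (c i * g.@[y i]) *: linf (y i) ^+ s.

Lemma gint_is_linear s : linear (gint s).
Proof.
move=> a g h; rewrite /gint scaler_sumr -big_split; apply: eq_bigr => i _ /=.
by rewrite mevalD mevalZ scalerA -scalerDl; congr (_ *: _); ring.
Qed.
HB.instance Definition _ s :=
  GRing.isLinear.Build R {mpoly R[n]} {mpoly R[M]} _ (gint s) (gint_is_linear s).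

Lemma gintS s g : gint s.+1 g = \sum_l x l * gint s ('X_l * g).
Proof.
under eq_bigr do rewrite mulr_sumr.
rewrite exchange_big; apply: eq_bigr => i _ /=.
rewrite exprS {1}/linf mulr_suml scaler_sumr; apply: eq_bigr => l _.
by rewrite mevalM mevalXU -scalerAl -scalerAr scalerA; congr (_ *: _); ring.
Qed.

(** The last term is the derivative s x_l <x,y>^(s-1) of the kernel. The design only knows test
    polynomials in y with real coefficients, so the induction moves the factors of <x,y>^s into g
    one at a time. *)
Lemma gint_ibp s l g : (msize g + s <= N)%N ->
  gint s ('X_l * g) = gint s g^`M(l) + s%:R *: (x l * gint s.-1 g).
Proof.
elim: s g => [|s IH] g hs.
  rewrite scale0r addr0 /gint; under eq_bigr do rewrite expr0 alg_mpolyC.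
  under [RHS]eq_bigr do rewrite expr0 alg_mpolyC.
  rewrite -!raddf_sum /=; congr (_ %:MP); case: Dy => _ _ /(_ l g) <-; last by rewrite -(addn0 (msize g)).
  by apply: eq_bigr => i _; rewrite mevalM mevalXU.
have hX a : (msize ('X_a * g)%R + s <= N)%N.
  apply: leq_trans hs; rewrite addnS -addSn leq_add2r. exact: msizeXM_leq.
rewrite gintS; under eq_bigr => a _.
  rewrite (_ : 'X_a * ('X_l * g) = 'X_l * ('X_a * g)); last by rewrite mulrCA.
  rewrite IH // mderivM mderivXU linearD /= mulrDr mulrDr; over.
rewrite big_split big_split /= -(gintS s g^`M(l)).
have -> : \sum_(a < n) x a * gint s ((a == l)%:R * g) = x l * gint s g.
  rewrite (bigD1 l) //= eqxx mul1r big1 ?addr0 // => a /negbTE ->.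
  by rewrite mul0r linear0 mulr0.
have -> : \sum_(a < n) x a * (s%:R *: (x l * gint s.-1 ('X_a * g))) = s%:R *: (x l * gint s g).
  case: s {IH hs hX} => [|s]; first by rewrite scale0r big1 // => a _; rewrite scale0r mulr0.
  rewrite gintS mulr_sumr scaler_sumr; apply: eq_bigr => a _.
  by rewrite -scalerAr mulrCA.
by rewrite -addrA addrCA -[s.+1%:R]natr1 scalerDl scale1r [in RHS](addrC (_ *: _)).
Qed.

Lemma gint_harmonicS s k (h : {mpoly R[n]}) : harmonic_homog k h -> (k + s.+1 <= N)%N ->
  gint s.+1 h = \sum_l x l * gint s h^`M(l) + s%:R *: (sqx * gint s.-1 h).
Proof.
move=> hh hs; rewrite gintS.
under eq_bigr => l _.
  rewrite gint_ibp; last by rewrite (leq_trans _ hs) // addnS -addSn leq_add2r dhomog_msize_leq //; case: hh.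
  rewrite mulrDr -scalerAr mulrA -expr2; over.
by rewrite big_split /= -scaler_sumr -mulr_suml.
Qed.

(** Integration by parts sends h to its partial derivatives, harmonic of degree k - 1, which Euler's
    identity reassembles into k h(x); this is the recursion of [gcoef]. For s = 0 and k > 0, k times
    the mean of h is the mean of its Laplacian, hence 0. *)
Lemma gint_harmonic s k (h : {mpoly R[n]}) : harmonic_homog k h -> (k + s <= N)%N ->
  gint s h = gcoef s k *: (sqx ^+ ((s - k)./2) * (h \mPo X)).
Proof.
have eul k' (h' : {mpoly R[n]}) : harmonic_homog k' h' ->
    \sum_l x l * (h'^`M(l) \mPo X) = k'%:R *: (h' \mPo X).
  case=> hh _; rewrite -comp_mpolyZ -(euler_homog hh) raddf_sum /=; apply: eq_bigr => l _.
  by rewrite rmorphM /= comp_mpolyXU -tnth_nth tnth_mktuple.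
elim/ltn_ind: s k h => -[|[|s]] IH k h hh hs.
- rewrite expr0 mul1r.
  have [k0|k0] := posnP k.
    have -> : h = (h@_0)%:MP.
      by apply: msize1_polyC; rewrite -[1%N]/(0.+1) -k0 dhomog_msize_leq //; case: hh.
    rewrite comp_mpolyC k0 scale1r /gint; under eq_bigr do rewrite expr0 alg_mpolyC mevalC.
    by rewrite -raddf_sum -mulr_suml; case: Dy => _ -> _; rewrite mul1r.
  have -> : gcoef 0 k = 0 by rewrite gcoef_lt.
  rewrite scale0r; apply/eqP; have : k%:R *: gint 0 h == 0.
    rewrite -linearZ /= -(euler_homog (proj1 hh)) raddf_sum /=.
    under eq_bigr => l _.
      rewrite gint_ibp; last first.
        have [hl _] := harmonic_mderiv l hh; rewrite addn0.
        by rewrite (leq_trans (dhomog_msize_leq hl)) // prednK // -(addn0 k).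
      rewrite scale0r addr0; over.
    by rewrite -raddf_sum /= -/(laplacian h); case: hh => _ ->; rewrite raddf0.
  by rewrite scaler_eq0 pnatr_eq0 eqn0Ngt k0.
- rewrite (gint_harmonicS hh hs) scale0r addr0.
  have hs' : (k.-1 + 0 <= N)%N by rewrite addn0 (leq_trans (leq_pred _)) // (leq_trans _ hs) // leq_addr.
  under eq_bigr => l _ do rewrite (IH 0 isT k.-1 _ (harmonic_mderiv l hh) hs') expr0 mul1r -scalerAr.
  rewrite -scaler_sumr (eul k) // scalerA.
  case: k {hh hs hs'} => [|[|k]]; rewrite ?mulr0 ?expr0 ?mul1r ?mulr1 //.
  by rewrite !gcoef_lt // mul0r !scale0r.
- rewrite (gint_harmonicS hh hs).
  have hs' : (k.-1 + s.+1 <= N)%N by rewrite (leq_trans _ hs) // leq_add ?leq_pred.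
  have hs2 : (k + s <= N)%N by rewrite (leq_trans _ hs) // leq_add2l (leq_trans (leqnSn _)).
  under eq_bigr => l _ do rewrite (IH s.+1 _ k.-1 _ (harmonic_mderiv l hh) hs') // -scalerAr mulrCA.
  rewrite -scaler_sumr -mulr_sumr (eul k) //= (IH s _ k h hh hs2) // gcoefSS scalerDl.
  congr (_ + _).
    rewrite -scalerAr scalerA mulrC; case: k {hh hs hs' hs2} => [|k]; first by rewrite !mul0r !scale0r.
    by rewrite subSS.
  rewrite -scalerAr scalerA mulrA -exprS.
  have [sk|ks] := ltnP s k; first by rewrite gcoef_lt // mulr0 !scale0r.
  by rewrite -addn2 -addnBAC // addn2.
Qed.

Definition sqX : {mpoly R[n]} := \sum_l 'X_l ^+ 2.

Lemma sqX_homog : sqX \is 2.-homog.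
Proof.
by apply: rpred_sum => l _; apply: (@dhomogMn _ _ _ 1); rewrite dhomogX /= mdeg1.
Qed.

(** Integrating y_l by parts, n comes from the derivative of the other factor y_l, k from Euler's
    identity for g and s from the kernel. Iterated, this produces the factors of [rho]. *)
Lemma gint_sqX s k (g : {mpoly R[n]}) : g \is k.-homog -> (k + s + 2 <= N)%N ->
  gint s (sqX * g) = (n + (k + s))%:R *: gint s g.
Proof.
move=> hg hs; rewrite /sqX mulr_suml raddf_sum /=.
have hm : (msize g <= k.+1)%N by exact: dhomog_msize_leq.
under eq_bigr => l _.
  rewrite expr2 -mulrA gint_ibp; last first.
    rewrite (leq_trans _ hs) // addn2 -addSn -addSn leq_add2r.
    by rewrite (leq_trans (msizeXM_leq _ _)).
  rewrite mderivM mderivXU eqxx mul1r linearD /=; over.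
rewrite !big_split /= sumr_const card_ord -raddf_sum /= (euler_homog hg) linearZ /=.
rewrite -scaler_sumr -scaler_nat !natrD !scalerDl -addrA; congr (_ + (_ + _)).
case: s hs => [|s] hs; first by rewrite !scale0r.
by rewrite -gintS.
Qed.

Lemma gint_sqXn a s k (g : {mpoly R[n]}) : g \is k.-homog -> (k + s + a.*2 <= N)%N ->
  gint s (sqX ^+ a * g) = (\prod_(i < a) (n + (k + s) + i.*2)%:R) *: gint s g.
Proof.
move=> hg; elim: a => [|a IH] hs; first by rewrite big_ord0 scale1r expr0 mul1r.
have hga : sqX ^+ a * g \is (2 * a + k).-homog.
  by apply: dhomogM => //; apply: dhomogMn; apply: sqX_homog.
rewrite exprS -mulrA (gint_sqX hga); last first.
  by rewrite (leq_trans _ hs) // doubleS -mul2n; lia.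
rewrite IH; last by rewrite (leq_trans _ hs) // leq_add2l leq_double.
rewrite scalerA big_ord_recr /= mulrC; congr (_ * _%:R *: _).
rewrite -mul2n; lia.
Qed.
End FunkHecke.
Arguments gcoef : simpl never.

(** * From Gaussian to spherical designs *)

Section SphereDesign.
Variables (R : realType) (n : nat).
Hypothesis n0 : (0 < n)%N.

(** Exactness is encoded as the Funk-Hecke formula itself up to total degree N, so that no measure
    on the sphere is needed. *)
Definition sphere_design N (I : finType) (W : I -> R) (u : I -> 'I_n -> R) : Prop :=
  [/\ forall i, 0 <= W i, forall i, sphere (u i) &
   forall k s (h : {mpoly R[n]}) M (x : 'I_n -> {mpoly R[M]}),
     harmonic_homog k h -> (k + s <= N)%N ->
     \sum_i (W i * h.@[u i]) *: linf x (u i) ^+ s =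
     scoef R n k s *: (sqx x ^+ ((s - k)./2) * (h \mPo [tuple x l | l < n]))].

Lemma sphereE (v : 'I_n -> R) : sphere v = (\sum_l v l ^+ 2 = 1).
Proof. by []. Qed.

Lemma linfZ M (x : 'I_n -> {mpoly R[M]}) a v : linf x (fun l => a * v l) = a *: linf x v.
Proof. by rewrite /linf scaler_sumr; apply: eq_bigr => l _; rewrite scalerA. Qed.

Lemma sqXE (v : 'I_n -> R) : (sqX R n).@[v] = \sum_l v l ^+ 2.
Proof. by rewrite raddf_sum; apply: eq_bigr => l _; rewrite /= rmorphXn /= mevalXU. Qed.

Lemma unit_direction (y : 'I_n -> R) : exists r : R * ('I_n -> R),
  [/\ 0 <= r.1, sphere r.2 & y =1 fun l => r.1 * r.2 l].
Proof.
pose q := \sum_l y l ^+ 2; have q0 : 0 <= q by apply: sumr_ge0 => l _; apply: sqr_ge0.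
have [qz|qp] := eqVneq q 0.
  exists (0, fun l => (l == Ordinal n0)%:R); split=> //=.
    rewrite sphereE (bigD1 (Ordinal n0)) //= ?eqxx expr1n big1 ?addr0 // => l /negbTE ->.
    by rewrite expr0n.
  move=> l; rewrite mul0r; apply/eqP; rewrite -sqrf_eq0.
  by apply/eqP; apply: (psumr_eq0P _ qz) => // l' _; apply: sqr_ge0.
exists (Num.sqrt q, fun l => y l / Num.sqrt q); split=> /=.
- exact: sqrtr_ge0.
- rewrite sphereE; under eq_bigr do rewrite expr_div_n.
  by rewrite -mulr_suml -/q sqr_sqrtr // divff.
- by move=> l; rewrite mulrC divfK // sqrtr_eq0 -ltNge lt_def qp.
Qed.

(* Every homogeneous polynomial of degree at most 2D, raised to degree 2D by a power of
   |y|^2, has the same Gaussian and spherical mean up to the factor [rho n D]; hence radially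
   projecting a Gaussian design and symmetrizing it yields a spherical design. *)
Lemma sphere_design_exists N :
  exists (I : finType) (W : I -> R) (u : I -> 'I_n -> R), sphere_design N W u.
Proof.
have [D hD] : exists D, D = N.+1 by exists N.+1.
have [J [c [y Dy]]] := @gauss_design_exists R n D.*2; have [c0 _ _] := Dy.
have [ru hru] := choice (fun i => unit_direction (y i)).
pose r i := (ru i).1; pose v i := (ru i).2.
have yE i : y i =1 fun l => r i * v i l by case: (hru i).
(* The boolean is a sign: u and -u cancel in odd total degree, where the radial weight would leave
   an odd power of |y|, which is no polynomial. *)
exists (J * bool)%type, (fun ib : J * bool => c ib.1 * r ib.1 ^+ D.*2 / rho R n D / 2%:R),
  (fun (ib : J * bool) l => (-1) ^+ ib.2 * v ib.1 l); split.
- move=> [i b] /=; rewrite !divr_ge0 ?ler0n ?mulr_ge0 ?exprn_ge0 ?(ltW (rho_gt0 R D n0)) //.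
  by case: (hru i).
- move=> [i b] /=; rewrite sphereE; under eq_bigr do rewrite exprMn sqrr_sign mul1r.
  by case: (hru i).
move=> k s h M x hh hks; have [hk _] := hh.
rewrite -(pair_bigA _ (fun i (b : bool) => (c i * r i ^+ D.*2 / rho R n D / 2%:R *
  h.@[fun l => (-1) ^+ b * v i l]) *: linf x (fun l => (-1) ^+ b * v i l) ^+ s)) /=.
have e i : \sum_(b : bool) (c i * r i ^+ D.*2 / rho R n D / 2%:R *
  h.@[fun l => (-1) ^+ b * v i l]) *: linf x (fun l => (-1) ^+ b * v i l) ^+ s =
  (~~ odd (k + s))%:R *: ((c i * r i ^+ D.*2 / rho R n D * h.@[v i]) *: linf x (v i) ^+ s).
  under eq_bigr => b _.
    rewrite (meval_homogZ _ _ hk) linfZ exprZn !scalerA.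
    rewrite (_ : _ * _ * _ = (c i * r i ^+ D.*2 / rho R n D * h.@[v i]) *
      ((-1) ^+ b ^+ (k + s) / 2%:R)); last by rewrite exprD; ring.
    over.
  rewrite big_bool /= expr1 expr0 expr1n -scalerDl -mulrDr scalerA [in RHS]mulrC; congr (_ * _ *: _).
  rewrite -signr_odd; case: (odd _); rewrite /= ?expr1 ?expr0; lra.
under eq_bigr do rewrite e.
rewrite -scaler_sumr; case ho : (odd (k + s)).
  by rewrite /scoef gcoef_odd ?mul0r ?scale0r // addnC.
rewrite scale1r; pose b := (k + s)./2; pose a := (D - b)%N.
have hb : b.*2 = (k + s)%N by rewrite /b halfK ho subn0.
have hbD : (b <= D)%N by rewrite -leq_double hb hD; lia.
have -> : \sum_i (c i * r i ^+ D.*2 / rho R n D * h.@[v i]) *: linf x (v i) ^+ s =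
   (rho R n D)^-1 *: gint c y x s (sqX R n ^+ a * h).
  rewrite /gint scaler_sumr; apply: eq_bigr => i _; rewrite scalerA.
  have -> : linf x (y i) = r i *: linf x (v i).
    by rewrite -linfZ; apply: eq_bigr => l _; rewrite yE.
  rewrite mevalM rmorphXn /= (meval_eq _ (yE i)) (meval_eq _ (yE i)).
  rewrite (meval_homogZ _ _ hk) (meval_homogZ _ _ (sqX_homog R n)) sqXE.
  have -> : \sum_l v i l ^+ 2 = 1 by case: (hru i).
  rewrite exprZn scalerA; congr (_ *: _).
  (* The weight r^(2D) supplies the radial factors of |y|^(2a), h(y) and <x,y>^s. *)
  rewrite (_ : D.*2 = 2 * a + k + s)%N; last by rewrite -(subnK hbD) -/a doubleD hb mul2n addnA.
  rewrite mulr1 -exprM !exprD; ring.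
rewrite (gint_sqXn Dy x hk); last by rewrite -hb -doubleD leq_double addnC subnK.
rewrite (gint_harmonic Dy x hh); last by rewrite (leq_trans hks) // hD; lia.
rewrite !scalerA; congr (_ *: _); rewrite /scoef -/b.
have -> : rho R n D = rho R n b * \prod_(i < a) (n + (k + s) + i.*2)%:R.
  have -> : rho R n D = rho R n (b + a) by rewrite addnC subnK.
  rewrite /rho big_split_ord /=; congr (_ * _).
  by apply: eq_bigr => i _; rewrite doubleD hb addnA.
have hP : \prod_(i < a) (n + (k + s) + i.*2)%:R != 0 :> R.
  by apply/prodf_neq0 => i _; rewrite pnatr_eq0 -lt0n !addn_gt0 n0.
have hb0 : rho R n b != 0 by rewrite gt_eqF // rho_gt0.
by field; rewrite hb0 hP.
Qed.
End SphereDesign.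

(** * Harmonic decomposition and the harmonic constant *)

Section HarmonicDecomposition.
Variables (R : realType) (n : nat).
Hypothesis n0 : (0 < n)%N.
Local Notation sqX := (sqX R n).
Local Notation Delta := (@laplacian R n).

Lemma laplacian_is_linear : linear Delta.
Proof.
by move=> a p q; rewrite /laplacian scaler_sumr -big_split; apply: eq_bigr => l _; rewrite /= !linearP.
Qed.
HB.instance Definition _ :=
  GRing.isLinear.Build R {mpoly R[n]} {mpoly R[n]} _ Delta laplacian_is_linear.

Lemma laplacian_homog k p : p \is k.-homog -> Delta p \is k.-2.-homog.
Proof. by move=> hp; apply: rpred_sum => l _; apply: dhomog_mderiv; apply: dhomog_mderiv. Qed.

Lemma laplacian_low k p : (k < 2)%N -> p \is k.-homog -> Delta p = 0.
Proof.
move=> k2 hp; apply: big1 => l _.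
have /dhomog_msize_leq : p^`M(l) \is 0.-homog.
  by have := dhomog_mderiv l hp; case: k k2 {hp} => [|[]].
by move/msize1_polyC => ->; rewrite mderivC.
Qed.

Lemma mderiv_sqX l : sqX^`M(l) = 2%:R * 'X_l.
Proof.
rewrite linear_sum (bigD1 l) //= big1 ?addr0 => [|a al].
  by rewrite expr2 mderivM mderivXU eqxx /= mulr1n; ring.
by rewrite expr2 mderivM mderivXU (negbTE al) mul0r mulr0 addr0.
Qed.

Lemma laplacian_sqX e g : g \is e.-homog ->
  Delta (sqX * g) = (n.*2 + e * 4)%:R *: g + sqX * Delta g.
Proof.
move=> hg; have d2 l : (sqX * g)^`M(l)^`M(l) =
    2%:R * g + 4%:R * ('X_l * g^`M(l)) + sqX * g^`M(l)^`M(l).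
  have two : (2%:R : {mpoly R[n]})^`M(l) = 0 by rewrite -mpolyC_nat mderivC.
  have dX : ('X_l : {mpoly R[n]})^`M(l) = 1 by rewrite mderivXU eqxx.
  by rewrite !(mderivM, mderivD, mderiv_sqX, dX, two); ring.
rewrite /laplacian; under eq_bigr do rewrite d2.
rewrite !big_split /= -!mulr_sumr (euler_homog hg) sumr_const card_ord; congr (_ + _).
rewrite -!mul_mpolyC !mpolyC_nat -mulr_natl natrD -muln2 !natrM; ring.
Qed.

Lemma laplacian_sqXn i e : exists2 c : R, 0 < c & forall g, g \is e.-homog ->
  Delta (sqX ^+ i.+1 * g) = c *: (sqX ^+ i * g) + sqX ^+ i.+1 * Delta g.
Proof.
elim: i => [|i [c c0 IH]].
  exists (n.*2 + e * 4)%:R; first by rewrite ltr0n addn_gt0 double_gt0 n0.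
  by move=> g hg; rewrite expr1 expr0 mul1r; apply: laplacian_sqX.
exists ((n.*2 + (2 * i.+1 + e) * 4)%:R + c).
  by rewrite ltr_wpDl ?ler0n.
move=> g hg; rewrite exprS -mulrA (@laplacian_sqX (2 * i.+1 + e)); last first.
  by apply: dhomogM => //; apply: dhomogMn; apply: sqX_homog.
rewrite IH // mulrDr -!scalerAr mulrA -exprS scalerDl addrA; congr (_ + _).
by rewrite mulrA -exprS.
Qed.

(** The Laplacian of |x|^(2i+2) g is a positive multiple of |x|^(2i) g plus |x|^(2i+2) Delta g; the
    last term is removed by induction, Delta g having degree e - 2. The power i is general because
    it grows in each round. *)
Lemma laplacian_sqX_surj e i g : g \is e.-homog ->
  exists2 G, G \is (e + i.*2).-homog & Delta (sqX * G) = sqX ^+ i * g.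
Proof.
elim/ltn_ind: e i g => e IH i g hg.
have [c c0 hc] := laplacian_sqXn i e.
have hXg : sqX ^+ i * g \is (e + i.*2).-homog.
  by rewrite addnC -mul2n; apply: dhomogM => //; apply: dhomogMn; apply: sqX_homog.
have [G1 hG1 eG1] : exists2 G1, G1 \is (e + i.*2).-homog & Delta (sqX * G1) = sqX ^+ i.+1 * Delta g.
  case: (ltnP e 2) => e2.
    by exists 0; rewrite ?rpred0 // mulr0 linear0 (laplacian_low e2 hg) mulr0.
  have e2lt : (e.-2 < e)%N by case: e e2 {IH hg hc hXg} => [|[|e]] // _; rewrite ltnS leqnSn.
  have [G1 hG1 eG1] := IH _ e2lt i.+1 _ (laplacian_homog hg).
  exists G1 => //; suff -> : (e + i.*2 = e.-2 + i.+1.*2)%N by [].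
  by case: e e2 {IH hg hc hXg hG1 eG1 e2lt} => [|[|e]] // _; rewrite doubleS !addnS.
exists (c^-1 *: (sqX ^+ i * g - G1)); first by rewrite rpredZ // rpredB.
rewrite -scalerAr linearZ mulrBr mulrA -exprS linearB /= hc // eG1 addrK scalerA mulVf ?scale1r //.
by rewrite gt_eqF.
Qed.

Lemma harmonic0 k : harmonic_homog k (0 : {mpoly R[n]}).
Proof. by split; rewrite ?rpred0 // linear0. Qed.

(** Solving Delta(|x|^2 G0) = Delta p makes p - |x|^2 G0 harmonic of degree e, and |x|^2 G0 = G0 -
    (1 - |x|^2) G0 leaves G0, of degree e - 2, to the induction. So the cofactor never exceeds
    degree e - 2. *)
Lemma harmonic_decomposition e p : p \is e.-homog ->
  exists h : nat -> {mpoly R[n]}, [/\ forall k, harmonic_homog k (h k),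
    forall k, (e < k)%N -> h k = 0 &
    exists2 G, (msize G <= e.-1)%N & p = \sum_(k < e.+1) h k + (1 - sqX) * G].
Proof.
elim/ltn_ind: e p => e IH p hp.
have only q : \sum_(k < e.+1) (if (k : nat) == e then q else 0) = q :> {mpoly R[n]}.
  rewrite big_ord_recr /= eqxx big1 ?add0r // => k _.
  by rewrite ltn_eqF.
case: (ltnP e 2) => e2.
  exists (fun k => if k == e then p else 0); split.
  - move=> k; case: eqP => [->|_]; last exact: harmonic0.
    by split=> //; apply: laplacian_low hp.
  - by move=> k; case: eqP => // ->; rewrite ltnn.
  - by exists 0; rewrite ?msize0 // only mulr0 addr0.
case: e e2 IH hp only => [|[|e]] // _ IH hp only.
have [G0 hG0 eG0] := laplacian_sqX_surj 0 (laplacian_homog hp).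
rewrite addn0 expr0 mul1r /= in hG0 eG0.
have [h [hh h0 [G mG eG]]] := IH e (ltnW (ltnSn _)) G0 hG0.
have hq : p - sqX * G0 \is e.+2.-homog.
  by rewrite rpredB // -add2n; apply: dhomogM => //; apply: sqX_homog.
exists (fun k => (if k == e.+2 then p - sqX * G0 else 0) + h k); split.
- move=> k; case: eqP => [->|_]; last by rewrite add0r.
  by rewrite h0 ?addr0 //; split=> //; rewrite linearB /= eG0 subrr.
- by move=> k hk; rewrite h0 ?addr0; [case: eqP hk => // ->; rewrite ltnn | rewrite (leq_trans _ hk) // ltnS ltnW].
exists (G - G0).
  rewrite (leq_trans (msizeD_le _ _)) // geq_max msizeN (leq_trans mG) ?dhomog_msize_leq //=.
  by rewrite (leq_trans (leq_pred _)).
rewrite big_split /= only !big_ord_recr /= (h0 e.+2) ?(h0 e.+1) // !addr0.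
rewrite big_ord_recr /= in eG; rewrite -[in LHS](subrK (sqX * G0) p); ring: eG.
Qed.
End HarmonicDecomposition.

(** * Projection onto harmonic components in the sup norm *)

Section HarmonicConstant.
Variables (R : realType) (n : nat).
Hypothesis n0 : (0 < n)%N.

Definition dotf (u v : 'I_n -> R) : R := \sum_l u l * v l.

Lemma sphere_design_eval N (I : finType) (W : I -> R) (u : I -> 'I_n -> R) k s h v :
  sphere_design N W u -> sphere v -> harmonic_homog k h -> (k + s <= N)%N ->
  \sum_i W i * h.@[u i] * dotf (u i) v ^+ s = scoef R n k s * h.@[v].
Proof.
case=> _ _ Dh vs hh hks.
have /(congr1 (meval v)) := Dh k s h n (fun l => 'X_l) hh hks.
rewrite mevalZ mevalM rmorphXn /= comp_mpoly_id /sqx -/(sqX R n) sqXE vs expr1n mul1r => <-.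
rewrite raddf_sum; apply: eq_bigr => i _ /=; rewrite mevalZ rmorphXn /=; congr (_ * _ ^+ _).
by rewrite raddf_sum; apply: eq_bigr => l _; rewrite /= mevalZ mevalXU.
Qed.

(* The matrix of the [scoef R n j s] is triangular with nonzero diagonal, so some polynomial kernel of
   degree d reproduces H_k and annihilates the other H_j. *)
Lemma zonal_kernel d k : (k <= d)%N -> exists z : 'I_d.+1 -> R,
  forall j, (j <= d)%N -> \sum_s z s * scoef R n j s = (j == k)%:R.
Proof.
move=> kd; pose C : 'M[R]_d.+1 := \matrix_(s, j) scoef R n j s.
have Ct : is_trig_mx C.
  by apply/is_trig_mxP => s j sj; rewrite mxE /scoef gcoef_lt ?mul0r.
have Cu : C \in unitmx.
  rewrite unitmxE (det_trig Ct) unitfE; apply/prodf_neq0 => j _.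
  by rewrite mxE /scoef gcoef_diag mulf_neq0 ?invr_eq0 ?pnatr_eq0 -?lt0n ?fact_gt0 // gt_eqF // rho_gt0.
exists (fun s => (invmx C) (inord k) s) => j jd.
have /matrixP /(_ (inord k) (inord j)) := mulVmx Cu.
rewrite !mxE -val_eqE /= !inordK // eq_sym => <-; apply: eq_bigr => s _.
by rewrite mxE inordK.
Qed.

Lemma sphere_coord_le1 (v : 'I_n -> R) l : sphere v -> `|v l| <= 1.
Proof.
rewrite sphereE => vs; rewrite -(@ler_pXn2r _ 2) ?nnegrE // expr1n real_normK ?num_real //.
by rewrite -vs (bigD1 l) //= lerDl sumr_ge0 // => a _; apply: sqr_ge0.
Qed.

Lemma sph_norm_has_sup (p : {mpoly R[n]}) : has_sup [set `|p.@[v]| | v in @sphere R n]%classic.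
Proof.
split.
  have [r [_ rs _]] := unit_direction n0 (fun _ : 'I_n => 0 : R).
  by exists `|p.@[r.2]|; exists r.2.
exists (\sum_(m <- msupp p) `|p@_m|) => _ [v vs <-].
rewrite mevalE (le_trans (ler_norm_sum _ _ _)) // ler_sum // => m _.
rewrite normrM ler_piMr ?normr_ge0 // normr_prod prodr_ile1 // => l _.
by rewrite normr_ge0 normrX exprn_ile1 ?normr_ge0 // sphere_coord_le1.
Qed.

Lemma sph_norm_ge (p : {mpoly R[n]}) v : sphere v -> `|p.@[v]| <= sph_norm p.
Proof.
by move=> vs; apply: sup_upper_bound; [exact: sph_norm_has_sup | exists v].
Qed.

Lemma sph_norm_le (p : {mpoly R[n]}) B : (forall v, sphere v -> `|p.@[v]| <= B) -> sph_norm p <= B.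
Proof.
move=> h; apply: ge_sup; first by case: (sph_norm_has_sup p).
by move=> _ [v vs <-]; apply: h.
Qed.

Lemma sph_norm_ge0 (p : {mpoly R[n]}) : 0 <= sph_norm p.
Proof.
have [[_ [v vs _]] _] := sph_norm_has_sup p.
by rewrite (le_trans (normr_ge0 _) (sph_norm_ge p vs)).
Qed.

(** Each p_k(v) is a finite sum of the values p(u_i) against a fixed zonal kernel. The existence of
    some B shows that the set defining [gammaS] is bounded, so that its supremum is a true one. *)
Lemma harmonic_part_bounded d : exists2 B : R, 0 <= B &
  forall (p : {mpoly R[n]}) pk, (forall k, (k <= d)%N -> harmonic_homog k (pk k)) ->
   (forall v, sphere v -> p.@[v] = \sum_(k < d.+1) (pk k).@[v]) ->
   forall k, (k <= d)%N -> sph_norm (pk k) <= B * sph_norm p.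
Proof.
have [I [W [u Du]]] := @sphere_design_exists R n n0 (d + d).
have [W0 us _] := Du.
have [z hz] : exists z : nat -> 'I_d.+1 -> R, forall k, (k <= d)%N ->
    forall j, (j <= d)%N -> \sum_s z k s * scoef R n j s = (j == k)%:R.
  have /choice [z hz] : forall k, exists zk : 'I_d.+1 -> R, (k <= d)%N ->
      forall j, (j <= d)%N -> \sum_s zk s * scoef R n j s = (j == k)%:R.
    move=> k; case: (leqP k d) => kd; last by exists (fun=> 0).
    by have [zk hzk] := zonal_kernel kd; exists zk.
  by exists z.
pose B := \sum_(k < d.+1) \sum_i W i * \sum_s `|z k s| * n%:R ^+ s.
have B0 k : 0 <= \sum_i W i * \sum_(s < d.+1) `|z k s| * n%:R ^+ s.
  by apply: sumr_ge0 => i _; rewrite mulr_ge0 ?W0 ?sumr_ge0 // => s _; rewrite mulr_ge0 ?exprn_ge0.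
exists B; first by apply: sumr_ge0.
move=> p pk hpk hp k kd; apply: sph_norm_le => v vs.
have -> : (pk k).@[v] = \sum_i W i * p.@[u i] * \sum_s z k s * dotf (u i) v ^+ s.
  under eq_bigr => i _ do rewrite mulr_sumr.
  rewrite exchange_big /=.
  under eq_bigr => s _.
    under eq_bigr => i _ do rewrite (hp _ (us i)) mulr_sumr mulr_suml.
    rewrite exchange_big /=.
    under eq_bigr => j _.
      under eq_bigr => i _ do rewrite mulrCA.
      rewrite -mulr_sumr (sphere_design_eval Du vs (hpk j _)); first over; first by rewrite -ltnS.
      by rewrite leq_add // -ltnS.
    over.
  rewrite exchange_big /= (bigD1 (Ordinal (kd : (k < d.+1)%N))) //=.
  under eq_bigr do rewrite mulrA.
  rewrite -mulr_suml hz // eqxx mul1r big1 ?addr0 // => j jk.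
  under eq_bigr do rewrite mulrA.
  rewrite -mulr_suml hz //; last by rewrite -ltnS.
  by move: jk; rewrite -val_eqE /= => /negbTE ->; rewrite mul0r.
rewrite (le_trans (ler_norm_sum _ _ _)) // (le_trans (_ : _ <= (\sum_i W i * \sum_(s < d.+1) `|z k s| * n%:R ^+ s) * sph_norm p)) //.
  rewrite mulr_suml ler_sum // => i _.
  rewrite normrM normrM ger0_norm // mulrAC ler_pM ?mulr_ge0 //; last exact: sph_norm_ge.
  rewrite ler_wpM2l // (le_trans (ler_norm_sum _ _ _)) // ler_sum // => s _.
  rewrite normrM ler_wpM2l // normrX lerXn2r ?nnegrE //.
  rewrite (le_trans (ler_norm_sum _ _ _)) // -[n in n%:R]card_ord -sum1_card natr_sum ler_sum // => l _.
  by rewrite normrM mulr_ile1 // sphere_coord_le1.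
rewrite ler_wpM2r ?sph_norm_ge0 // /B [leRHS](bigD1 (Ordinal (kd : (k < d.+1)%N))) //= lerDl.
exact: sumr_ge0.
Qed.

Lemma gammaS_bound d (p : {mpoly R[n]}) pk : deg_le p d ->
   (forall k, (k <= d)%N -> harmonic_homog k (pk k)) ->
   (forall v, sphere v -> p.@[v] = \sum_(k < d.+1) (pk k).@[v]) ->
   forall k v, (k <= d)%N -> sphere v -> `|(pk k).@[v]| <= gammaS R n d * sph_norm p.
Proof.
have [B B0 hB] := harmonic_part_bounded d.
move=> dp hpk hp k v kd vs; rewrite (le_trans (sph_norm_ge _ vs)) //.
(* Polynomials vanishing on the sphere are excluded from [gammaS]; for them the bound by B shows
   that all components vanish there. *)
have [pz|/eqP pz] := eqVneq (sph_norm p) 0; first by have := hB p pk hpk hp k kd; rewrite pz !mulr0.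
have pos : 0 < sph_norm p by rewrite lt_def sph_norm_ge0 andbT; apply/eqP.
have [w ws pw] : exists2 w, sphere w & p.@[w] != 0.
  apply/not_exists2P => hw; apply: pz; apply/eqP; rewrite eq_le sph_norm_ge0 andbT.
  apply: sph_norm_le => w ws; case: (hw w) => // /negP; rewrite negbK => /eqP ->.
  by rewrite normr0.
rewrite -ler_pdivrMr //; apply: sup_upper_bound; last first.
  exists p; split=> //; first by exists w.
  by exists pk; split=> //; exists k.
split.
  exists (sph_norm (pk k) / sph_norm p), p; split=> //; first by exists w.
  by exists pk; split=> //; exists k.
exists B => _ [p' [dp' [w' ws' pw'] [pk' [hpk' hp' [k' kd' ->]]]]].
rewrite ler_pdivrMr ?hB // (lt_le_trans _ (sph_norm_ge p' ws')) // normr_gt0 //.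
Qed.

Lemma gammaS_ge0 d : 0 <= gammaS R n d.
Proof.
have d1 : deg_le (1 : {mpoly R[n]}) d by rewrite /deg_le msize1.
pose pk (k : nat) : {mpoly R[n]} := if k == 0%N then 1 else 0.
have hpk k : (k <= d)%N -> harmonic_homog k (pk k).
  move=> _; rewrite /pk; case: eqP => [->|_]; last exact: harmonic0.
  by split; [exact: dhomog1 | rewrite (@laplacian_low _ _ 0) ?dhomog1].
have hp v : sphere v -> (1 : {mpoly R[n]}).@[v] = \sum_(k < d.+1) (pk k).@[v].
  by move=> _; rewrite big_ord_recl /= big1 ?addr0 // => k _; rewrite meval0.
have [r [_ rs _]] := unit_direction n0 (fun _ : 'I_n => 0 : R).
have := @gammaS_bound d _ _ d1 hpk hp 0 r.2 isT rs; rewrite /pk /= meval1 normr1 => h.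
have hs : 0 <= sph_norm (1 : {mpoly R[n]}) by exact: sph_norm_ge0.
by rewrite leNgt; apply/negP => g0; move: (le_lt_trans (le_trans h (mulr_le0_ge0 (ltW g0) hs)) ltr01); rewrite ltxx.
Qed.
End HarmonicConstant.

(** * Gegenbauer polynomials and the kernel density *)

Section ZonalMoments.
Variables (R : realType) (n : nat).
Hypothesis n0 : (0 < n)%N.

Local Notation lam := (mfun (scoef R n 0)).

Lemma scoef0_rec s : (n + s)%:R * scoef R n 0 s.+2 = s.+1%:R * scoef R n 0 s.
Proof.
rewrite /scoef !add0n gcoefSS mul0r add0r /= /rho big_ord_recr /= -/(rho R n _).
case os: (odd s); first by rewrite gcoef_odd ?addn0 // mulr0 !mul0r !mulr0.
have -> : (n + s./2.*2 = n + s)%N by rewrite halfK os subn0.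
have ? := rho_gt0 R s./2 n0; have ns : (n + s)%:R != 0 :> R by rewrite pnatr_eq0 -lt0n addn_gt0 n0.
by field; rewrite -natrD ns gt_eqF.
Qed.

Lemma scoef00 : scoef R n 0 0 = 1.
Proof. by rewrite /scoef /rho big_ord0 divr1. Qed.

Lemma scoef01 : scoef R n 0 1 = 0.
Proof. by rewrite /scoef gcoef_odd // mul0r. Qed.

(** For n > 1 a coordinate on the sphere has density proportional to (1 - u^2)^((n-3)/2); this is
    its integration by parts, read off the moment recursion [scoef0_rec]. *)
Lemma zonal_ibp (g : {poly R}) : lam ((1 - 'X ^+ 2) * g^`()) = n.-1%:R * lam ('X * g).
Proof.
have [N [c ->]] : exists N (c : nat -> R), g = \sum_(i < N) c i *: 'X^i.
  by exists (size g), (fun i => g`_i); rewrite -poly_def coefK.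
have -> : (\sum_(i < N) c i *: 'X^i)^`() = \sum_(i < N) c i *: ('X^i)^`() :> {poly R}.
  by rewrite linear_sum; apply: eq_bigr => i _; rewrite linearZ.
rewrite [(1 - _) * _]mulr_sumr ['X * _]mulr_sumr !raddf_sum mulr_sumr; apply: eq_bigr => i _ /=.
rewrite derivXn -!scalerAr !mfunZ mulrCA; congr (_ * _).
case: (nat_of_ord i) => [|s] /=.
  by rewrite mulr0n mulr0 raddf0 mulr1 -['X]expr1 mfunXn scoef01 mulr0.
rewrite mulrnAr raddfMn /= mulrBl mul1r -exprD -exprS raddfB /= !mfunXn add2n -mulr_natl.
rewrite -[_ *+ s.+1]mulr_natl mulrBr -(scoef0_rec s) -{1}(prednK n0); ring.
Qed.
End ZonalMoments.

Section ZonalPolynomials.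
Variables (R : realType) (p : nat).
Local Notation n := p.+2.
Local Notation lam := (mfun (scoef R n 0)).

(* Gegenbauer polynomials of the sphere in R^(p+2), with value 1 at 1. *)
Fixpoint zpoly (j : nat) : {poly R} :=
  match j with
  | 0 => 1
  | 1 => 'X
  | (j'.+1 as j1).+1 => (j' + p).+1%:R^-1 *: ((j'.*2 + n)%:R * 'X * zpoly j1 - j1%:R * zpoly j')
  end.
Arguments zpoly : simpl never.

Lemma zpolySSE j : zpoly j.+2 =
  (j + p).+1%:R^-1 *: ((j.*2 + n)%:R * 'X * zpoly j.+1 - j.+1%:R * zpoly j).
Proof. by []. Qed.

Lemma zpolySS j : (j + p).+1%:R * zpoly j.+2 = (j.*2 + n)%:R * 'X * zpoly j.+1 - j.+1%:R * zpoly j.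
Proof.
by rewrite zpolySSE -[_.+1%:R]polyC_natr mul_polyC scalerA divff ?scale1r // pnatr_eq0.
Qed.

Lemma size_zpoly j : (size (zpoly j) <= j.+1)%N.
Proof.
elim/ltn_ind: j => -[|[|j]] IH; first by rewrite size_poly1.
  by rewrite size_polyX.
rewrite zpolySSE (leq_trans (size_scale_leq _ _)) // (leq_trans (size_polyD _ _)) // geq_max size_polyN.
rewrite -mulrA -!polyC_natr !mul_polyC; apply/andP; split.
  rewrite (leq_trans (size_scale_leq _ _)) // (leq_trans (size_polyMleq _ _)) // size_polyX /=.
  by rewrite ltnS IH.
by rewrite (leq_trans (size_scale_leq _ _)) // (leq_trans (IH j _)) // ltnS ltnW.
Qed.

(** After differentiating the three-term recurrence, the first identity at j + 2 needs the second at
    j and the first at j + 1, and then yields the second; hence the joint induction. *)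
Lemma zpoly_deriv_down j :
  (1 - 'X ^+ 2) * (zpoly j)^`() = j%:R * (zpoly j.-1 - 'X * zpoly j) /\
  (1 - 'X ^+ 2) * (zpoly j)^`() = (j + p)%:R * ('X * zpoly j - zpoly j.+1).
Proof.
elim/ltn_ind: j => -[|[|j]] IH.
- by rewrite derivC !mulr0 mul0r mulr1 subrr mulr0.
- have h : (1 - 'X ^+ 2) * (zpoly 1)^`() = 1%:R * (zpoly 0 - 'X * zpoly 1).
    rewrite derivX /zpoly; ring.
  split=> //; rewrite h; have := zpolySS 0; rewrite /= !add0n add1n => e.
  rewrite [RHS]mulrBr e; ring.
have [[_ hB] [hA _]] := (IH j (leqnSn _), IH j.+1 (ltnSn _)).
have e := zpolySS j; have de := congr1 (fun q => (1 - 'X ^+ 2) * q^`()) e.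
have nz : (j + p).+1%:R != 0 :> {poly R} by rewrite -polyC_natr polyC_eq0 pnatr_eq0.
have h : (1 - 'X ^+ 2) * (zpoly j.+2)^`() = j.+2%:R * (zpoly j.+1 - 'X * zpoly j.+2).
  apply: (mulfI nz).
  have dn k : (k%:R : {poly R})^`() = 0 by rewrite -polyC_natr derivC.
  move: de; rewrite !(derivM, derivB, dn, derivX) mul0r add0r !mul0r !add0r mulr1 => de.
  have -> : (j + p).+1%:R * ((1 - 'X ^+ 2) * (zpoly j.+2)^`()) =
    (1 - 'X^2) * ((j + p).+1%:R * (zpoly j.+2)^`()) by ring.
  rewrite de.
  have -> : (j + p).+1%:R * (j.+2%:R * (zpoly j.+1 - 'X * zpoly j.+2)) =
    j.+2%:R * ((j + p).+1%:R * zpoly j.+1 - 'X * ((j + p).+1%:R * zpoly j.+2)) by ring.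
  rewrite e.
  have -> : (1 - 'X ^+ 2) * ((j.*2 + n)%:R * zpoly j.+1 + (j.*2 + n)%:R * 'X * (zpoly j.+1)^`() - j.+1%:R * (zpoly j)^`())
   = (1 - 'X ^+ 2) * (j.*2 + n)%:R * zpoly j.+1 + (j.*2 + n)%:R * 'X * ((1 - 'X ^+ 2) * (zpoly j.+1)^`()) - j.+1%:R * ((1 - 'X ^+ 2) * (zpoly j)^`()).
    ring.
  rewrite hA hB -muln2 /=; ring.
split=> //; rewrite h; have e' := zpolySS j.+1.
rewrite [RHS]mulrBr [(j.+2 + p)%N]addSn e' -!muln2; ring.
Qed.

(** [zin] is the Gram matrix of the Gegenbauer polynomials, [zjac] that of multiplication by u. *)
Definition zin a b := lam (zpoly a * zpoly b).
Definition zjac a b := lam ('X * (zpoly a * zpoly b)).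

Lemma zinC a b : zin a b = zin b a. Proof. by rewrite /zin mulrC. Qed.

Lemma zjacE a b : (p.+1 + a + b)%:R * zjac a b = a%:R * zin a.-1 b + b%:R * zin a b.-1.
Proof.
have [hA _] := zpoly_deriv_down a; have [hB _] := zpoly_deriv_down b.
have := zonal_ibp (isT : (0 < n)%N) (zpoly a * zpoly b).
have -> : (1 - 'X ^+ 2) * (zpoly a * zpoly b)^`() =
  a%:R *: (zpoly a.-1 * zpoly b) + b%:R *: (zpoly a * zpoly b.-1)
   - (a + b)%:R *: ('X * (zpoly a * zpoly b)).
  have -> : (1 - 'X ^+ 2) * (zpoly a * zpoly b)^`() =
      ((1 - 'X ^+ 2) * (zpoly a)^`()) * zpoly b + zpoly a * ((1 - 'X ^+ 2) * (zpoly b)^`()).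
    by rewrite derivM; ring.
  rewrite hA hB -!mul_polyC !polyC_natr natrD; ring.
rewrite raddfB raddfD /= !mfunZ -/(zin _ _) -/(zin _ _) -/(zjac _ _) => e.
by rewrite -addnA natrD mulrDl -e; ring.
Qed.

Lemma zjac_rec a b : (a.*2 + p)%:R * zjac a b = (a + p)%:R * zin a.+1 b + a%:R * zin a.-1 b.
Proof.
rewrite /zjac /zin -!mfunZ -raddfD /=; congr mfun; rewrite -!mul_polyC !polyC_natr.
case: a => [|a] /=; first by rewrite !add0n mul0r addr0 mul1r.
rewrite [in RHS]mulrA addSn zpolySS doubleS -addn2; ring.
Qed.

(** [zjacE] comes from integration by parts and [zjac_rec] from the recurrence; comparing them
    isolates the entry of highest index, the others vanishing by induction on a + b. If the indices
    differ by two, a diagonal entry survives in both, but there the coefficients of [zjac] coincide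
    and it cancels. *)
Lemma zin_ortho a b : (b < a)%N -> zin a b = 0.
Proof.
have [s] := ubnP (a + b)%N; elim: s a b => // s IH [//|a] b hs ba.
have hJ := zjacE a b.
have b1 : b%:R * zin a b.-1 = 0.
  by case: b ba hs {hJ} => [|b] ba hs; rewrite ?mul0r // IH ?mulr0 //=; lia.
rewrite b1 addr0 in hJ; have hR := zjac_rec a b.
(* The coefficient a + p vanishes only for a = p = 0, where the claim is that u has mean 0. *)
have [ap|ap] := posnP (a + p)%N.
  have a0 : a = 0%N by lia.
  move: hJ; rewrite a0 mul0r => /eqP; rewrite mulf_eq0 pnatr_eq0 /= => /eqP.
  by rewrite /zjac /zin mul1r.
suff h : (a + p)%:R * zin a.+1 b = 0.
  by move/eqP: h; rewrite mulf_eq0 pnatr_eq0 eqn0Ngt ap => /eqP.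
have [e|ne] := eqVneq a b.+1.
  move: hJ hR; have -> : (p.+1 + a + b = a.*2 + p)%N by rewrite e -addnn; lia.
  by move=> ->; move/eqP; rewrite eq_sym -subr_eq0 addrK => /eqP.
have e1 : a%:R * zin a.-1 b = 0.
  case: a ba ne hs {hJ hR ap b1} => [|a] ba ne hs; first by rewrite mul0r.
  have [e|ne'] := eqVneq b a.+1; first by rewrite e zinC /= IH ?mulr0 //; lia.
  by rewrite /= IH ?mulr0 //; lia.
move: hJ hR; rewrite e1 => /eqP; rewrite mulf_eq0 pnatr_eq0 /= => /eqP ->.
by rewrite mulr0 addr0 => <-.
Qed.
End ZonalPolynomials.
Arguments zpoly : simpl never.

Section TrialFunction.
Variables (R : realType) (p : nat).
Local Notation n := p.+2.
Local Notation lam := (mfun (scoef R n 0)).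
Local Notation zpoly := (zpoly R p).
Local Notation zin := (zin R p).
Local Notation zjac := (zjac R p).

Lemma zin_lam a b : lam (zpoly a * zpoly b) = zin a b.
Proof. by []. Qed.

Lemma zjac_lam a b : lam ('X * (zpoly a * zpoly b)) = zjac a b.
Proof. by []. Qed.

Lemma zin_neq a b : a != b -> zin a b = 0.
Proof. by case: ltngtP => // h _; [rewrite zinC|]; apply: zin_ortho. Qed.

(** The case a = b is included, so the Jacobi matrix has only its two off-diagonals. *)
Lemma zjac_far a b : b != a.+1 -> a != b.+1 -> zjac a b = 0.
Proof.
move=> h1 h2; have := zjacE R p a b.
have -> : a%:R * zin a.-1 b = 0 by case: a h1 h2 => [|a] h1 h2; rewrite ?mul0r // zin_neq ?mulr0 // -eqSS.
have -> : b%:R * zin a b.-1 = 0 by case: b h1 h2 => [|b] h1 h2; rewrite ?mul0r // zin_neq ?mulr0 // -eqSS eq_sym.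
by rewrite addr0 => /eqP; rewrite mulf_eq0 pnatr_eq0 /= => /eqP.
Qed.

Lemma zjac_next a : (a.*2 + n)%:R * zjac a a.+1 = a.+1%:R * zin a a.
Proof.
have := zjacE R p a a.+1; have -> : (p.+1 + a + a.+1 = a.*2 + n)%N by rewrite -addnn; lia.
move=> ->; have -> : a%:R * zin a.-1 a.+1 = 0 by rewrite zin_neq ?mulr0 // ltn_eqF // ltnS leq_pred.
by rewrite add0r.
Qed.

Lemma zjac_next' a : (a.*2 + p)%:R * zjac a a.+1 = (a + p)%:R * zin a.+1 a.+1.
Proof.
rewrite zjac_rec; have -> : a%:R * zin a.-1 a.+1 = 0 by rewrite zin_neq ?mulr0 // ltn_eqF // ltnS leq_pred.
by rewrite addr0.
Qed.

(** [zjac_next] and [zjac_next'] express one entry by the norms of both neighbours, so positivity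
    climbs from a to a + 1. The step from 0 is direct, as the coefficient a + p may be 0 there. *)
Lemma zin_gt0 a : 0 < zin a a.
Proof.
elim: a => [|a IH]; first by rewrite -zin_lam mulr1 -[zpoly 0]/('X^0) mfunXn scoef00.
have d0 : 0 < (a.*2 + n)%:R :> R by rewrite ltr0n addnS.
have J0 : 0 < zjac a a.+1 by rewrite -(pmulr_rgt0 _ d0) zjac_next mulr_gt0 // ltr0n.
case: a IH d0 J0 => [|a] IH d0 J0.
  by move: J0; rewrite -zin_lam -zjac_lam mul1r.
by rewrite -(pmulr_rgt0 _ (_ : 0 < (a.+1 + p)%:R)) ?ltr0n // -zjac_next' mulr_gt0 // ltr0n doubleS.
Qed.

Definition znorm a : R := Num.sqrt (zin a a).

Lemma znorm_gt0 a : 0 < znorm a. Proof. by rewrite sqrtr_gt0 zin_gt0. Qed.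

Lemma znorm_sqr a : znorm a ^+ 2 = zin a a.
Proof. by rewrite sqr_sqrtr // ltW // zin_gt0. Qed.

Definition zbeta a : R := zjac a a.+1 / (znorm a * znorm a.+1).

(** The two expressions for the entry give 4 beta^2 = 1 - p (p - 2) / ((2a + p + 2) (2a + p)) >= 1 -
    x with x = p^2 / (4 a (a + 1)); for x < 1, (1 - x)^2 <= 1 - x removes the square. *)
Lemma zbeta_ge a : (0 < a)%N -> 1 - p%:R ^+ 2 / 4%:R / (a%:R * a.+1%:R) <= 2%:R * zbeta a.
Proof.
move=> a0; have hJ := zjac_next a; have hJ' := zjac_next' a.
have h0 := zin_gt0 a; have h1 := zin_gt0 a.+1.
have d1 : 0 < (a.*2 + n)%:R :> R by rewrite ltr0n addnS.
have d2 : 0 < (a.*2 + p)%:R :> R by rewrite ltr0n addn_gt0 double_gt0 a0.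
have d3 : 0 < (a + p)%:R :> R by rewrite ltr0n addn_gt0 a0.
have ap : 0 < a%:R :> R by rewrite ltr0n.
have p0 : 0 <= p%:R :> R by [].
have J0 : 0 < zjac a a.+1.
  by rewrite -(pmulr_rgt0 _ d1) hJ mulr_gt0 // ltr0n.
have b2 : zbeta a ^+ 2 = (a.+1%:R * (a + p)%:R) / ((a.*2 + n)%:R * (a.*2 + p)%:R).
  rewrite expr_div_n exprMn !znorm_sqr.
  have -> : zin a a = (a.*2 + n)%:R * zjac a a.+1 / a.+1%:R by rewrite hJ mulrC mulKf // pnatr_eq0.
  have -> : zin a.+1 a.+1 = (a.*2 + p)%:R * zjac a a.+1 / (a + p)%:R by rewrite hJ' mulrC mulKf // gt_eqF.
  have ? : (zjac a a.+1 != 0) by rewrite gt_eqF.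
  by field; rewrite ?gt_eqF //; lra.
have b0 : 0 <= zbeta a by rewrite divr_ge0 ?(ltW J0) ?mulr_ge0 // ltW // znorm_gt0.
have b0' : 0 <= 2%:R * zbeta a by apply: mulr_ge0.
set x := _ / (a%:R * _); have x0 : 0 <= x.
  by rewrite !divr_ge0 ?sqr_ge0 // mulr_ge0.
have [x1|x1] := lerP 1 x; first by rewrite (le_trans (_ : _ <= 0)) ?subr_le0.
rewrite -ler_sqr ?nnegrE ?subr_ge0 ?(ltW x1) //.
apply: (@le_trans _ _ (1 - x)); first by nra.
rewrite exprMn b2 /x lerBlDr -lerBlDl.
have -> : 1 - 2%:R ^+ 2 * (a.+1%:R * (a + p)%:R / ((a.*2 + n)%:R * (a.*2 + p)%:R))
  = (p%:R * (p%:R - 2%:R)) / ((a.*2 + n)%:R * (a.*2 + p)%:R) :> R.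
  have e1 : (a.*2 + n)%:R = 2%:R * a%:R + p%:R + 2%:R :> R by rewrite -muln2 !(natrD, natrM); ring.
  have e2 : (a.*2 + p)%:R = 2%:R * a%:R + p%:R :> R by rewrite -muln2 !(natrD, natrM); ring.
  rewrite e1 e2 natrD -natr1; field; apply/andP; split; lra.
have -> : p%:R ^+ 2 / 4%:R / (a%:R * a.+1%:R) = p%:R ^+ 2 / (4%:R * (a%:R * a.+1%:R)) :> R.
  by rewrite -mulrA -invfM.
rewrite ler_pdivrMr ?mulr_gt0 // mulrAC ler_pdivlMr ?mulr_gt0 ?ltr0n //.
have e1 : (a.*2 + n)%:R = 2%:R * a%:R + p%:R + 2%:R :> R by rewrite -muln2 !(natrD, natrM); ring.
have e2 : (a.*2 + p)%:R = 2%:R * a%:R + p%:R :> R by rewrite -muln2 !(natrD, natrM); ring.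
have e3 : a.+1%:R = a%:R + 1 :> R by rewrite natr1.
rewrite e1 e2 e3; move: (a%:R) (p%:R) ap p0 => u v ap p0.
have h : v * (v - 2) * (4 * (u * (u + 1))) <= v ^+ 2 * (4 * (u * (u + 1))).
  by rewrite ler_wpM2r //; nra.
apply: le_trans h _; rewrite ler_wpM2l ?sqr_ge0 //; nra.
Qed.

Lemma sqr_addZ (f g : {poly R}) c :
  (f + c *: g) ^+ 2 = f ^+ 2 + (2%:R * c) *: (f * g) + c ^+ 2 *: (g * g).
Proof. by rewrite -!mul_polyC rmorphM rmorphXn /= polyC_natr; ring. Qed.

Variable w : nat -> R.

(** The vector [w] in the orthonormal basis. The constant component is left out because [zbeta_ge]
    degenerates at a = 0. *)
Definition ztrial t : {poly R} := \sum_(j < t) (w j.+1 / znorm j.+1) *: zpoly j.+1.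

Lemma ztrialS t : ztrial t.+1 = ztrial t + (w t.+1 / znorm t.+1) *: zpoly t.+1.
Proof. by rewrite /ztrial big_ord_recr. Qed.

Lemma size_ztrial t : (size (ztrial t) <= t.+1)%N.
Proof.
rewrite (leq_trans (size_sum _ _ _)) //; apply/bigmax_leqP => j _.
by rewrite (leq_trans (size_scale_leq _ _)) // (leq_trans (size_zpoly _ _ _)) // ltnS.
Qed.

Lemma ztrial_ortho t k : (t < k)%N -> lam (ztrial t * zpoly k) = 0.
Proof.
move=> tk; rewrite [ztrial t * _]mulr_suml raddf_sum big1 // => j _ /=.
rewrite -scalerAl mfunZ zin_lam zin_neq ?mulr0 //.
by rewrite ltn_eqF // (leq_ltn_trans _ tk).
Qed.

Lemma ztrial_jac t k : (t.+1 < k)%N -> lam ('X * (ztrial t * zpoly k)) = 0.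
Proof.
move=> tk; rewrite [ztrial t * _]mulr_suml ['X * _]mulr_sumr raddf_sum big1 // => j _ /=.
rewrite -scalerAl -scalerAr mfunZ zjac_lam zjac_far ?mulr0 //; have := ltn_ord j; apply: contraTneq => e; lia.
Qed.

Lemma ztrial_sqr t : lam (ztrial t ^+ 2) = \sum_(j < t) w j.+1 ^+ 2.
Proof.
elim: t => [|t IH]; first by rewrite /ztrial !big_ord0 expr0n raddf0.
rewrite ztrialS big_ord_recr /= -IH; set c := w t.+1 / _.
rewrite sqr_addZ !raddfD /= !mfunZ ztrial_ortho // mulr0 addr0 zin_lam -znorm_sqr.
by rewrite /c expr_div_n divfK // sqrf_eq0 gt_eqF // znorm_gt0.
Qed.

Lemma ztrial_Xsqr t : lam ('X * ztrial t.+1 ^+ 2) =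
  \sum_(j < t) w j.+1 * w j.+2 * (2%:R * zbeta j.+1).
Proof.
have S k : lam ('X * ztrial k.+1 ^+ 2) = lam ('X * ztrial k ^+ 2) +
    2%:R * (w k.+1 / znorm k.+1) * lam ('X * (ztrial k * zpoly k.+1)).
  rewrite ztrialS; set c := w k.+1 / _.
  rewrite sqr_addZ !mulrDr -!scalerAr !raddfD /= !mfunZ -[lam ('X * (zpoly k.+1 * zpoly k.+1))]/(zjac k.+1 k.+1).
  by rewrite zjac_far ?mulr0 ?addr0 // ltn_eqF.
elim: t => [|t IH].
  by rewrite big_ord0 S /ztrial !big_ord0 expr0n mul0r !mulr0 !raddf0 mulr0 addr0.
rewrite big_ord_recr S IH /=; congr (_ + _).
rewrite {1}ztrialS [_ * zpoly t.+2]mulrDl ['X * _]mulrDr raddfD /= ztrial_jac // add0r -scalerAl -scalerAr mfunZ.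
rewrite zjac_lam /zbeta.
have ? := znorm_gt0 t.+1; have ? := znorm_gt0 t.+2.
by field; rewrite !gt_eqF.
Qed.
End TrialFunction.

Section Kernel.
Variable R : realType.

Lemma sum_sqr_hat (T : R) k : \sum_(j < k) (j.+1%:R * (T - j.+1%:R)) ^+ 2 =
  T ^+ 2 * (k%:R * k.+1%:R * (2%:R * k%:R + 1) / 6%:R) - 2%:R * T * (k%:R ^+ 2 * k.+1%:R ^+ 2 / 4%:R)
  + k%:R * k.+1%:R * (2%:R * k%:R + 1) * (3%:R * k%:R ^+ 2 + 3%:R * k%:R - 1) / 30%:R.
Proof.
elim: k => [|k IH]; first by rewrite big_ord0; field.
by by rewrite big_ord_recr /= IH -!natr1; field.
Qed.

Lemma sum_next_hat (T : R) k :
  \sum_(j < k) (j.+1%:R * (T - j.+1%:R)) * (j.+2%:R * (T - j.+2%:R)) =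
  (T ^+ 2 - T) * (k%:R * k.+1%:R * k.+2%:R / 3%:R)
  - 2%:R * T * (k%:R * k.+1%:R * k.+2%:R * (3%:R * k%:R + 1) / 12%:R)
  + k%:R * k.+1%:R * k.+2%:R * (3%:R * k%:R ^+ 2 + 6%:R * k%:R + 1) / 15%:R.
Proof.
elim: k => [|k IH]; first by rewrite big_ord0; field.
by rewrite big_ord_recr /= IH -!natr1; field.
Qed.

(** For w_j = j (T - j) this sums w_j w_(j+1) / (j (j+1)), the weight of the perturbation in
    [zbeta_ge]. *)
Lemma sum_rest_hat (T : R) k :
  \sum_(j < k) (T - j.+1%:R) * (T - j.+2%:R) =
  k%:R * (T ^+ 2 - T) - T * (k%:R * k.+1%:R) + k%:R * k.+1%:R * k.+2%:R / 3%:R.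
Proof.
elim: k => [|k IH]; first by rewrite big_ord0; field.
by rewrite big_ord_recr /= IH -!natr1; field.
Qed.

(* For n > 1, f has coefficients j (t + 1 - j) in the orthonormal Gegenbauer basis, where
   multiplication by u differs from half the path adjacency matrix by O(n^2 / j^2); for n = 1,
   f is proportional to 1 + u. *)
Lemma zonal_density n t : (0 < n)%N -> (0 < t)%N -> exists f : {poly R},
  [/\ (size f <= t.+1)%N, mfun (scoef R n 0) (f ^+ 2) = 1 &
   mfun (scoef R n 0) ((1 - 'X) * f ^+ 2) <= 5%:R / 2%:R * n%:R ^+ 2 / t%:R ^+ 2].
Proof.
case: n => [|[|p]] // _; case: t => // t _.
  have s2 : scoef R 1 0 2 = 1 by have := scoef0_rec R (isT : (0 < 1)%N) 0; rewrite scoef00 !mul1r.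
  have s3 : scoef R 1 0 3 = 0.
    have := scoef0_rec R (isT : (0 < 1)%N) 1; rewrite scoef01 mulr0 => /eqP.
    by rewrite mulf_eq0 pnatr_eq0 /= => /eqP.
  have lX : mfun (scoef R 1 0) 'X = 0 by rewrite -['X]expr1 mfunXn scoef01.
  have l1 : mfun (scoef R 1 0) 1 = 1 by rewrite -(expr0 'X) mfunXn scoef00.
  have l2 : mfun (scoef R 1 0) ((1 + 'X) ^+ 2) = 2%:R.
    have -> : (1 + 'X) ^+ 2 = 1 + 'X + 'X + 'X ^+ 2 :> {poly R} by ring.
    by rewrite !raddfD /= l1 lX mfunXn s2; ring.
  (* For n = 1 the measure sits at -1 and 1, where (1 - u^2) (1 + u) vanishes. *)
  have l3 : mfun (scoef R 1 0) ((1 - 'X) * (1 + 'X) ^+ 2) = 0.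
    have -> : (1 - 'X) * (1 + 'X) ^+ 2 = 1 + 'X - 'X ^+ 2 - 'X ^+ 3 :> {poly R} by ring.
    by rewrite raddfB raddfB raddfD /= l1 lX !mfunXn s2 s3; ring.
  have r2 : (Num.sqrt 2%:R : R) ^+ 2 = 2%:R by rewrite sqr_sqrtr.
  exists ((Num.sqrt 2%:R)^-1 *: (1 + 'X)); split.
  - by rewrite (leq_trans (size_scale_leq _ _)) // addrC -polyC1 size_XaddC.
  - by rewrite exprZn mfunZ l2 exprVn r2 mulVf ?pnatr_eq0.
  - by rewrite exprZn -scalerAr mfunZ l3 mulr0 divr_ge0 ?exprn_ge0 // mulr_ge0 ?exprn_ge0 // divr_ge0 ?ler0n.
(* T is one above the degree bound. The weights j (T - j) vanish at both ends like the sine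
   eigenvector of the path, have closed-form sums, and their factor j cancels the denominators in
   [zbeta_ge]. *)
pose T : R := t.+2%:R; pose w j : R := j%:R * (T - j%:R).
have tE : t%:R = T - 2%:R :> R by rewrite /T -!natr1; ring.
have t1E : t.+1%:R = T - 1 :> R by rewrite /T -!natr1; ring.
have pE : p.+2%:R = p%:R + 2%:R :> R by rewrite -natrD addn2.
have T2 : 2%:R <= T by rewrite ler_nat.
have w0 j : (j <= t.+1)%N -> 0 <= w j.
  by move=> hj; rewrite mulr_ge0 // subr_ge0 ler_nat ltnW.
pose F := ztrial p w t.+1; pose S := mfun (scoef R p.+2 0) (F ^+ 2).
have SE : S = T * (T ^+ 4 - 1) / 30%:R.
  by rewrite /S ztrial_sqr sum_sqr_hat -/T t1E; field.
have S0 : 0 < S by rewrite SE; nra.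
have XF : T * (T ^+ 4 - 1) / 30%:R - T * (T ^+ 2 - 1) / 6%:R
    - p%:R ^+ 2 / 4%:R * ((T - 2%:R) * (T - 1) * T / 3%:R) <=
    mfun (scoef R p.+2 0) ('X * F ^+ 2).
  rewrite ztrial_Xsqr.
  apply: (@le_trans _ _ (\sum_(j < t) w j.+1 * w j.+2 * (1 - p%:R ^+ 2 / 4%:R / (j.+1%:R * j.+2%:R)))).
    rewrite (eq_bigr (fun j : 'I_t => (j.+1%:R * (T - j.+1%:R)) * (j.+2%:R * (T - j.+2%:R))
       - p%:R ^+ 2 / 4%:R * ((T - j.+1%:R) * (T - j.+2%:R)))); last first.
      move=> j _; have h1 : j.+1%:R != 0 :> R by rewrite pnatr_eq0.
      have h2 : j.+2%:R != 0 :> R by rewrite pnatr_eq0.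
      rewrite /w; move: (j.+1%:R) (j.+2%:R) h1 h2 => a b h1 h2; by field; rewrite h1 h2.
    rewrite sumrB -mulr_sumr sum_next_hat sum_rest_hat -/T t1E tE.
    by rewrite le_eqVlt; apply/orP; left; apply/eqP; field.
  apply: ler_sum => j _; rewrite ler_wpM2l ?zbeta_ge //.
  by rewrite mulr_ge0 ?w0 // ltnS // ltnW.
have rS : Num.sqrt S ^+ 2 = S by rewrite sqr_sqrtr // ltW.
exists ((Num.sqrt S)^-1 *: F); split.
- by rewrite (leq_trans (size_scale_leq _ _)) // size_ztrial.
- by rewrite exprZn mfunZ exprVn rS -/S mulVf // gt_eqF.
rewrite exprZn -scalerAr mfunZ exprVn rS mulrBl mul1r raddfB /= -/S.
rewrite mulrC ler_pdivrMr //; apply: (le_trans (lerB (lexx _) XF)).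
rewrite SE t1E pE.
have -> : T * (T ^+ 4 - 1) / 30%:R - (T * (T ^+ 4 - 1) / 30%:R - T * (T ^+ 2 - 1) / 6%:R - p%:R ^+ 2 / 4%:R * ((T - 2%:R) * (T - 1) * T / 3%:R)) = T * (T - 1) / 12%:R * (2%:R * (T + 1) + p%:R ^+ 2 * (T - 2%:R)).
  by field.
(* 5/2 is 30/12, the quotient of the denominators of the squared norm and of the defect. *)
have -> : 5%:R / 2%:R * (p%:R + 2%:R) ^+ 2 / (T - 1) ^+ 2 * (T * (T ^+ 4 - 1) / 30%:R) =
   T * (T - 1) / 12%:R * ((p%:R + 2%:R) ^+ 2 * (T + 1) * ((T ^+ 2 + 1) / (T - 1) ^+ 2)).
  by field; apply/eqP; lra.
rewrite ler_wpM2l //; first by rewrite divr_ge0 // mulr_ge0; lra.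
have p0 : 0 <= p%:R :> R by [].
have q1 : 1 <= (T ^+ 2 + 1) / (T - 1) ^+ 2 by rewrite ler_pdivlMr ?mul1r ?exprn_gt0; nra.
apply: (@le_trans _ _ ((p%:R + 2%:R) ^+ 2 * (T + 1))); first by nra.
by rewrite ler_peMr // mulr_ge0 ?sqr_ge0 //; lra.
Qed.
End Kernel.

(** * Eigenvalues of the kernel operator *)

Section ComplexPower.
Variables (R : realType) (a b : R).

Fixpoint cpow (k : nat) : R * R :=
  if k is k'.+1 then (a * (cpow k').1 - b * (cpow k').2, a * (cpow k').2 + b * (cpow k').1)
  else (1, 0).

Lemma cpowS k : cpow k.+1 =
  (a * (cpow k).1 - b * (cpow k).2, a * (cpow k).2 + b * (cpow k).1).
Proof. by []. Qed.

Hypothesis ab1 : a ^+ 2 + b ^+ 2 <= 1.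

Lemma cpow_norm k : (cpow k).1 ^+ 2 + (cpow k).2 ^+ 2 = (a ^+ 2 + b ^+ 2) ^+ k.
Proof.
elim: k => [|k IH] /=; first by rewrite expr0n expr1n addr0.
by rewrite [RHS]exprS -IH; ring.
Qed.

Lemma cpow_dist k :
  (1 - (cpow k).1) ^+ 2 + (cpow k).2 ^+ 2 <= k%:R ^+ 2 * ((1 - a) ^+ 2 + b ^+ 2).
Proof.
elim: k => [|[|k] IH]; first by rewrite /= subrr expr0n addr0 mul0r.
  by rewrite /= !mulr1 !mulr0 subr0 add0r expr1n mul1r.
move: IH; rewrite [cpow k.+2]cpowS; move: (cpow k.+1) => [A B] /= IH.
set D := (1 - a) ^+ 2 + b ^+ 2 in IH *; set E := (1 - A) ^+ 2 + B ^+ 2 in IH.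
have k0 : 0 < k.+1%:R :> R by rewrite ltr0n.
have D0 : 0 <= D by rewrite addr_ge0 ?sqr_ge0.
have E0 : 0 <= E by rewrite addr_ge0 ?sqr_ge0.
(* 1 - z^(k+1) = (1 - z) + z (1 - z^k), then AM-GM with weight k on the cross term. *)
pose x1 := 1 - a; pose x2 := - b; pose y1 := a * (1 - A) + b * B; pose y2 := b * (1 - A) - a * B.
have e1 : (1 - (a * A - b * B)) ^+ 2 + (a * B + b * A) ^+ 2 = (x1 + y1) ^+ 2 + (x2 + y2) ^+ 2.
  by rewrite /x1 /x2 /y1 /y2; ring.
have eD : D = x1 ^+ 2 + x2 ^+ 2 by rewrite /D /x1 /x2; ring.
have eE : y1 ^+ 2 + y2 ^+ 2 = (a ^+ 2 + b ^+ 2) * E by rewrite /E /y1 /y2; ring.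
have yE : y1 ^+ 2 + y2 ^+ 2 <= k.+1%:R ^+ 2 * D by rewrite eE (le_trans _ IH) // ler_piMl.
rewrite e1 -[k.+2%:R]natr1; move: (k.+1%:R) k0 yE => c k0 yE {IH}.
have am (x y : R) : (x + y) ^+ 2 <= (1 + c) * x ^+ 2 + (1 + c^-1) * y ^+ 2.
  rewrite -subr_ge0 (_ : _ - _ = c^-1 * (c * x - y) ^+ 2); last by field; rewrite gt_eqF.
  by rewrite mulr_ge0 ?sqr_ge0 // invr_ge0 ltW.
apply: (le_trans (lerD (am x1 y1) (am x2 y2))).
rewrite addrACA -!mulrDr -eD.
have h2 : (1 + c^-1) * (y1 ^+ 2 + y2 ^+ 2) <= (1 + c^-1) * (c ^+ 2 * D).
  by rewrite ler_wpM2l // addr_ge0 // invr_ge0 ltW.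
apply: (le_trans (lerD (lexx _) h2)); rewrite le_eqVlt; apply/orP; left; apply/eqP.
by field; rewrite gt_eqF.
Qed.

(** For w = z^k, 2 (1 - Re w) = |1 - w|^2 + (1 - |w|^2), where the first term is at most k^2 |1 -
    z|^2 and the second at most k^2 (1 - |z|^2). *)
Lemma cpow_re k : 0 <= 1 - (cpow k).1 <= k%:R ^+ 2 * (1 - a).
Proof.
pose r := a ^+ 2 + b ^+ 2; have r0 : 0 <= r by rewrite addr_ge0 ?sqr_ge0.
have e : 2%:R * (1 - (cpow k).1) = (1 - (cpow k).1) ^+ 2 + (cpow k).2 ^+ 2 + (1 - r ^+ k).
  by rewrite -cpow_norm; ring.
have rk : 0 <= 1 - r ^+ k <= k%:R ^+ 2 * (1 - r).
  rewrite subr_ge0 exprn_ile1 //=; elim: k {e} => [|k IH]; first by rewrite subrr expr0n mul0r.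
  have rk0 : 0 <= r ^+ k by apply: exprn_ge0.
  have rk1 : r ^+ k <= 1 by apply: exprn_ile1.
  have k0 : 0 <= k%:R :> R by [].
  have r1 : r <= 1 by [].
  by rewrite exprS -natr1; move: (r ^+ k) (k%:R) IH rk0 rk1 k0 => s c; nra.
case/andP: rk => rk0 rkk; have d := cpow_dist k.
have s1 : 0 <= (1 - (cpow k).1) ^+ 2 by apply: sqr_ge0.
have s2 : 0 <= (cpow k).2 ^+ 2 by apply: sqr_ge0.
apply/andP; split; first lra.
have : k%:R ^+ 2 * ((1 - a) ^+ 2 + b ^+ 2) + k%:R ^+ 2 * (1 - r) = 2%:R * (k%:R ^+ 2 * (1 - a)) by rewrite /r; ring.
lra.
Qed.
End ComplexPower.

Section Eigenvalues.
Variables (R : realType) (n : nat).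
Hypothesis n0 : (0 < n)%N.
Local Notation i0 := (Ordinal n0).

Section HighestWeight.
Variable i1 : 'I_n.
Hypothesis i01 : i1 != i0.

Fixpoint hwpoly (k : nat) : {mpoly R[n]} * {mpoly R[n]} :=
  if k is k'.+1 then ('X_i0 * (hwpoly k').1 - 'X_i1 * (hwpoly k').2,
                      'X_i0 * (hwpoly k').2 + 'X_i1 * (hwpoly k').1)
  else (1, 0).

Lemma hwpoly_homog k : (hwpoly k).1 \is k.-homog /\ (hwpoly k).2 \is k.-homog.
Proof.
have hX l : ('X_l : {mpoly R[n]}) \is 1.-homog by rewrite dhomogX /= mdeg1.
elim: k => [|k [h1 h2]] /=; first by rewrite dhomog1 rpred0.
by rewrite -add1n rpredB ?rpredD // dhomogM.
Qed.

Lemma hwpoly_eval k v : (hwpoly k).1.@[v] = (cpow (v i0) (v i1) k).1 /\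
  (hwpoly k).2.@[v] = (cpow (v i0) (v i1) k).2.
Proof.
elim: k => [|k IH] /=; first by rewrite meval1 meval0.
by case: IH => <- <-; rewrite mevalB mevalD !mevalM !mevalXU.
Qed.

(** Cauchy-Riemann for z = x_0 + i x_1: the derivatives of z^k are k z^(k-1) and i k z^(k-1). The
    second mixes real and imaginary parts, so both are carried along. *)
Lemma hwpoly_deriv k l :
  (hwpoly k).1^`M(l) = (if l == i0 then k%:R * (hwpoly k.-1).1 else
     if l == i1 then - (k%:R * (hwpoly k.-1).2) else 0) /\
  (hwpoly k).2^`M(l) = (if l == i0 then k%:R * (hwpoly k.-1).2 else
     if l == i1 then k%:R * (hwpoly k.-1).1 else 0).
Proof.
elim: k => [|k [IH1 IH2]].
  rewrite /= -mpolyC1 mderivC linear0 !mul0r oppr0.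
  by case: (l == i0); case: (l == i1).
have [hA hB] : k%:R * ('X_i0 * (hwpoly k.-1).1 - 'X_i1 * (hwpoly k.-1).2) = k%:R * (hwpoly k).1 /\
   k%:R * ('X_i0 * (hwpoly k.-1).2 + 'X_i1 * (hwpoly k.-1).1) = k%:R * (hwpoly k).2.
  by case: k {IH1 IH2} => [|k]; rewrite ?mul0r.
rewrite /= mderivB mderivD !mderivM !mderivXU -natr1 IH1 IH2 {IH1 IH2} ![_ == l]eq_sym.
have [->|l0] := eqVneq l i0.
  rewrite eq_sym (negbTE i01) /= mulrDl -hA [(_ + 1) * (hwpoly k).2]mulrDl -hB /= mulr1n mulr0n.
  by split; ring.
have [_|l1] := eqVneq l i1.
  rewrite /= mulrDl -hB [(_ + 1) * (hwpoly k).1]mulrDl -hA /= mulr1n mulr0n.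
  by split; ring.
by rewrite /= mulr0n; split; ring.
Qed.

Lemma hwpoly_harmonic k : harmonic_homog k (hwpoly k).1.
Proof.
split; first by case: (hwpoly_homog k).
rewrite /laplacian (bigD1 i0) // (bigD1 i1) //= big1 => [|l /andP[l0 l1]]; last first.
  by rewrite (proj1 (hwpoly_deriv k l)) (negbTE l0) (negbTE l1) linear0.
have dn c l : (c%:R : {mpoly R[n]})^`M(l) = 0 by rewrite -mpolyC_nat mderivC.
rewrite !(proj1 (hwpoly_deriv k _)) !eqxx (negbTE i01) mderivN !mderivM !dn.
rewrite (proj1 (hwpoly_deriv k.-1 i0)) (proj2 (hwpoly_deriv k.-1 i1)) !eqxx (negbTE i01).
ring.
Qed.
End HighestWeight.

(** For n = 1 there is no second coordinate; the constant 1 and x_0 serve for k = 0 and k = 1. *)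
Lemma harmonic_peak k : (k <= 1)%N || (1 < n)%N -> exists A : {mpoly R[n]},
  [/\ harmonic_homog k A, A.@[fun l => (l == i0)%:R] = 1 &
   forall v, sphere v -> 0 <= 1 - A.@[v] <= k%:R ^+ 2 * (1 - v i0)].
Proof.
have [n1 _|n1] := ltnP 1 n.
  pose i1 : 'I_n := Ordinal n1; have i01 : i1 != i0 by [].
  exists (hwpoly i1 k).1; split; first exact: hwpoly_harmonic.
    have [-> _] := hwpoly_eval i1 k (fun l => (l == i0)%:R); rewrite eqxx (negbTE i01).
    have -> : cpow (true%:R : R) false%:R k = (1, 0); last by [].
    by elim: k => //= k ->; rewrite /= !mul0r mulr0 subr0 addr0 mulr1.
  move=> v vs; have [-> _] := hwpoly_eval i1 k v; apply: cpow_re.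
  move: vs; rewrite sphereE (bigD1 i0) // (bigD1 i1) //= addrA => <-.
  by rewrite lerDl sumr_ge0 // => l _; apply: sqr_ge0.
rewrite orbF; case: k => [|[|]] // _.
  exists 1; split; last by move=> v _; rewrite meval1 subrr lexx expr0n mul0r lexx.
    by split; rewrite ?dhomog1 // (@laplacian_low _ _ 0) ?dhomog1.
  by rewrite meval1.
have hX : ('X_i0 : {mpoly R[n]}) \is 1.-homog by rewrite dhomogX /= mdeg1.
exists 'X_i0; split; last first.
- move=> v vs; rewrite mevalXU expr1n mul1r lexx andbT subr_ge0.
  by rewrite (le_trans (ler_norm _)) // sphere_coord_le1.
- by rewrite mevalXU eqxx.
- by split=> //; apply: laplacian_low hX.
Qed.
Lemma funk_hecke N (I : finType) (W : I -> R) (u : I -> 'I_n -> R) k h v (s : {poly R}) :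
  sphere_design N W u -> sphere v -> harmonic_homog k h -> (k + size s <= N)%N ->
  \sum_i W i * h.@[u i] * s.[dotf (u i) v] = mfun (scoef R n k) s * h.@[v].
Proof.
move=> Du vs hh hs; under eq_bigr do rewrite horner_coef mulr_sumr.
rewrite exchange_big /mfun mulr_suml; apply: eq_bigr => j _ /=.
rewrite -mulrA -(sphere_design_eval Du vs hh); last first.
  by rewrite (leq_trans _ hs) // leq_add2l ltnW.
by rewrite mulr_sumr; apply: eq_bigr => i _; ring.
Qed.

(** Funk-Hecke at the pole e_0, where A = 1, writes the eigenvalue as the average of A against the
    density f(u_0)^2; the pointwise bound on 1 - A is then averaged. *)
Lemma eigenvalue_bound k (f : {poly R}) : (k <= 1)%N || (1 < n)%N ->
  mfun (scoef R n 0) (f ^+ 2) = 1 ->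
  0 <= 1 - mfun (scoef R n k) (f ^+ 2) <= k%:R ^+ 2 * mfun (scoef R n 0) ((1 - 'X) * f ^+ 2).
Proof.
move=> kn f1; have [A [hA A1 hv]] := harmonic_peak kn.
have [I [W [u Du]]] := @sphere_design_exists R n n0 (k + (size f).*2.+2).
have [W0 us _] := Du.
pose e l : R := (l == i0)%:R.
have es : sphere e.
  rewrite sphereE (bigD1 i0) //= /e eqxx expr1n big1 ?addr0 // => l /negbTE ->.
  by rewrite expr0n.
have dote i : dotf (u i) e = u i i0.
  rewrite /dotf (bigD1 i0) //= /e eqxx mulr1 big1 ?addr0 // => l /negbTE ->.
  by rewrite mulr0.
have one : harmonic_homog 0 (1 : {mpoly R[n]}).
  by split; rewrite ?dhomog1 // (@laplacian_low _ _ 0) ?dhomog1.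
have sf : (size (f ^+ 2)%R <= (size f).*2)%N.
  by rewrite expr2 (leq_trans (size_polyMleq _ _)) // addnn leq_pred.
have sXf : (size ((1 - 'X) * f ^+ 2)%R <= (size f).*2.+2)%N.
  rewrite (leq_trans (size_polyMleq _ _)) // -opprB size_polyN size_XsubC /=.
  by change (1 + size (f ^+ 2)%R <= (size f).*2.+2)%N; rewrite add1n ltnS (leq_trans sf).
have eA : \sum_i W i * A.@[u i] * f.[u i i0] ^+ 2 = mfun (scoef R n k) (f ^+ 2).
  rewrite -[RHS]mulr1 -{1}A1 -(funk_hecke Du es hA); last by rewrite leq_add2l (leq_trans sf) // ltnW.
  by apply: eq_bigr => i _; rewrite horner_exp dote.
have e1 (s : {poly R}) : (size s <= (size f).*2.+2)%N -> \sum_i W i * s.[u i i0] = mfun (scoef R n 0) s.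
  move=> hs; rewrite -[RHS]mulr1 -{1}(meval1 e) -(funk_hecke Du es one); last first.
    by rewrite add0n (leq_trans hs) // leq_addl.
  by apply: eq_bigr => i _; rewrite meval1 mulr1 dote.
have -> : 1 - mfun (scoef R n k) (f ^+ 2) = \sum_i W i * f.[u i i0] ^+ 2 * (1 - A.@[u i]).
  rewrite -{1}f1 -e1; last by rewrite (leq_trans sf) // ltnW.
  rewrite -eA -sumrB; apply: eq_bigr => i _; rewrite horner_exp; ring.
have -> : k%:R ^+ 2 * mfun (scoef R n 0) ((1 - 'X) * f ^+ 2) =
    \sum_i W i * f.[u i i0] ^+ 2 * (k%:R ^+ 2 * (1 - u i i0)).
  rewrite -e1 // mulr_sumr; apply: eq_bigr => i _.
  by rewrite hornerM hornerD hornerN horner_exp hornerC hornerX; ring.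
have Wf i : 0 <= W i * f.[u i i0] ^+ 2 by apply: mulr_ge0 => //; apply: sqr_ge0.
apply/andP; split.
  by apply: sumr_ge0 => i _; apply: mulr_ge0 => //; case/andP: (hv _ (us i)).
by apply: ler_sum => i _; rewrite ler_wpM2l //; case/andP: (hv _ (us i)).
Qed.
End Eigenvalues.

(** * Congruences modulo the ideal of a product of spheres *)

Section FilteredCongruence.
Variables (R : realType) (m n : nat).
Local Notation A := {mpoly R[m * n]}.

(* Congruence modulo the ideal of the product of spheres, with cofactors of degree at most D - 2
   (hence equality when D <= 1). *)
Definition scong D (a b : A) : Prop :=
  exists2 h : 'I_m -> A, (forall j, (msize (h j) <= D.-1)%N) &
    a - b = \sum_j h j * @gsph R m n j.

Lemma scong_refl D a : scong D a a.
Proof. by exists (fun=> 0) => [j|]; rewrite ?msize0 // subrr big1 // => j _; rewrite mul0r. Qed.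

Lemma scong_sym D a b : scong D a b -> scong D b a.
Proof.
move=> [h hs e]; exists (fun j => - h j) => [j|]; first by rewrite msizeN.
by under eq_bigr do rewrite mulNr; rewrite sumrN -e opprB.
Qed.

Lemma scong_leq D D' a b : (D <= D')%N -> scong D a b -> scong D' a b.
Proof.
move=> hD [h hs e]; exists h => // j; rewrite (leq_trans (hs j)) //.
by rewrite -!subn1 leq_sub2r.
Qed.

Lemma scong_trans D b a c : scong D a b -> scong D b c -> scong D a c.
Proof.
move=> [h hs e] [h' hs' e']; exists (fun j => h j + h' j) => [j|].
  by rewrite (leq_trans (msizeD_le _ _)) // geq_max hs hs'.
under eq_bigr do rewrite mulrDl.
by rewrite big_split /= -e -e' addrA subrK.
Qed.

Lemma scong_add D a b a' b' : scong D a b -> scong D a' b' -> scong D (a + a') (b + b').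
Proof.
move=> [h hs e] [h' hs' e']; exists (fun j => h j + h' j) => [j|].
  by rewrite (leq_trans (msizeD_le _ _)) // geq_max hs hs'.
under eq_bigr do rewrite mulrDl.
by rewrite big_split /= -e -e' opprD addrACA.
Qed.

Lemma scong_sum D (I : Type) (r : seq I) (P : pred I) (a b : I -> A) :
  (forall i, P i -> scong D (a i) (b i)) ->
  scong D (\sum_(i <- r | P i) a i) (\sum_(i <- r | P i) b i).
Proof.
move=> h; apply: (big_ind2 (fun a b => scong D a b)) => //; first exact: scong_refl.
by move=> *; apply: scong_add.
Qed.

Lemma scong_scale D c a b : scong D a b -> scong D (c *: a) (c *: b).
Proof.
move=> [h hs e]; exists (fun j => c *: h j) => [j|].
  by rewrite (leq_trans (msizeZ_le _ _)).
by rewrite -scalerBr e scaler_sumr; apply: eq_bigr => j _; rewrite scalerAl.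
Qed.

Lemma scong_mul D e c a b : scong D a b -> (msize c <= e.+1)%N -> scong (e + D) (c * a) (c * b).
Proof.
move=> [h hs eq] hc; exists (fun j => c * h j) => [j|]; last first.
  by rewrite -mulrBr eq mulr_sumr; apply: eq_bigr => j _; rewrite mulrA.
case: D hs => [|[|D]] /= hs.
- by have := hs j; rewrite leqn0 msize_poly_eq0 => /eqP ->; rewrite mulr0 msize0.
- by have := hs j; rewrite leqn0 msize_poly_eq0 => /eqP ->; rewrite mulr0 msize0.
- by rewrite !addnS /=; apply: msizeM_leq.
Qed.

Lemma scong_mul2 D E a b a' b' : scong D a b -> scong E a' b' ->
  (msize a <= D.+1)%N -> (msize b' <= E.+1)%N -> scong (D + E) (a * a') (b * b').
Proof.
move=> h h' sa sb'; apply: (@scong_trans _ (a * b')); first exact: scong_mul.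
by rewrite ![_ * b']mulrC addnC; apply: scong_mul.
Qed.

Lemma scong_prod (I : Type) (r : seq I) (P : pred I) (D : I -> nat) (a b : I -> A) :
  (forall i, [/\ scong (D i) (a i) (b i), (msize (a i) <= (D i).+1)%N & (msize (b i) <= (D i).+1)%N]) ->
  [/\ scong (\sum_(i <- r | P i) D i) (\prod_(i <- r | P i) a i) (\prod_(i <- r | P i) b i),
     (msize (\prod_(i <- r | P i) a i)%R <= (\sum_(i <- r | P i) D i).+1)%N
   & (msize (\prod_(i <- r | P i) b i)%R <= (\sum_(i <- r | P i) D i).+1)%N].
Proof.
move=> h; elim/big_rec3: _ => [|i x y N Pi [h1 h2 h3]].
  by rewrite msize1; split=> //; apply: scong_refl.
have [g1 g2 g3] := h i; split; [exact: scong_mul2 | exact: msizeM_leq | exact: msizeM_leq].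
Qed.

Lemma scong_evalX D a b P : scong D a b -> @prod_spheres R m n P -> evalX a P = evalX b P.
Proof.
move=> [h _ e] hP; apply/eqP; rewrite -subr_eq0 /evalX -mevalB e raddf_sum big1 // => j _ /=.
rewrite mevalM; suff -> : (@gsph R m n j).@[fun k => mxvec P 0 k] = 0 by rewrite mulr0.
rewrite -[RHS](hP j) /gsph mevalB meval1 [X in _ - X]raddf_sum; congr (1 - _).
by apply: eq_bigr => i _; rewrite /= rmorphXn /= mevalXU mxvecE.
Qed.

Definition blockX (j : 'I_m) (l : 'I_n) : A := 'X_(mxvec_index j l).
Definition block j (p : {mpoly R[n]}) : A := p \mPo [tuple blockX j l | l < n].

Lemma block_is_linear j : linear (block j).
Proof. by move=> a p q; rewrite /block linearP. Qed.
HB.instance Definition _ j :=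
  GRing.isLinear.Build R {mpoly R[n]} A _ (block j) (block_is_linear j).

Lemma blockM j p q : block j (p * q) = block j p * block j q.
Proof. by rewrite /block rmorphM. Qed.

Lemma block1 j : block j 1 = 1.
Proof. by rewrite /block rmorph1. Qed.

Lemma evalX_block j p P : evalX (block j p) P = p.@[P j].
Proof.
rewrite /evalX /block comp_mpoly_meval; apply: meval_eq => l.
by rewrite tnth_mktuple mevalXU mxvecE.
Qed.

Lemma msize_prod_leq (I : Type) (r : seq I) (D : I -> nat) (a : I -> A) :
  (forall i, (msize (a i) <= (D i).+1)%N) ->
  (msize (\prod_(i <- r) a i)%R <= (\sum_(i <- r) D i).+1)%N.
Proof.
move=> h; elim/big_rec2: _ => [|i x y _ hx]; first by rewrite msize1.
exact: msizeM_leq.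
Qed.

Lemma msize_exp_leq k D (a : A) : (msize a <= D.+1)%N -> (msize (a ^+ k)%R <= (k * D).+1)%N.
Proof.
move=> h; elim: k => [|k IH]; first by rewrite expr0 msize1.
by rewrite exprS mulSn; apply: msizeM_leq.
Qed.

Lemma msize_block j p : (msize (block j p) <= msize p)%N.
Proof.
rewrite /block comp_mpolyEX (leq_trans (msize_sum _ _ _)) //.
apply/bigmax_leqP_seq => k hk _; rewrite (leq_trans (msizeZ_le _ _)) //.
rewrite (leq_trans _ (msize_mdeg_lt hk)) // comp_mpolyX mdegE.
apply: msize_prod_leq => l; rewrite -[X in (_ <= X.+1)%N]muln1; apply: msize_exp_leq.
by rewrite tnth_mktuple msizeX mdeg1.
Qed.

Lemma block_sqX j : block j (sqX R n) = 1 - @gsph R m n j.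
Proof.
rewrite /gsph subKr /block raddf_sum /=; apply: eq_bigr => l _.
by rewrite rmorphXn /= comp_mpolyXU -tnth_nth tnth_mktuple.
Qed.

Lemma scong_sqx j a : [/\ scong (a * 2) (block j (sqX R n) ^+ a) 1,
  (msize (block j (sqX R n) ^+ a)%R <= (a * 2).+1)%N & (msize (1%R : A) <= (a * 2).+1)%N].
Proof.
have h : scong 2 (block j (sqX R n)) 1.
  exists (fun i => if i == j then -1 else 0) => [i|].
    by case: eqP => _; rewrite ?msizeN ?msize1 ?msize0.
  rewrite (bigD1 j) //= eqxx big1 => [|i /negbTE ->]; last by rewrite mul0r.
  by rewrite block_sqX; ring.
have s : (msize (block j (sqX R n)) <= 3)%N.
  by rewrite (leq_trans (msize_block _ _)) // dhomog_msize_leq // sqX_homog.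
elim: a => [|a [h1 h2 h3]]; first by rewrite expr0 msize1; split=> //; apply: scong_refl.
rewrite exprS mulSn; split; rewrite ?msize1 //; last exact: msizeM_leq.
by rewrite -[X in scong _ _ X]mulr1; apply: scong_mul2.
Qed.

Definition hev (f : {poly R}) (z : A) : A := (map_poly (@mpolyC _ R) f).[z].

Lemma hevE f z : hev f z = \sum_(s < size f) f`_s *: z ^+ s.
Proof.
rewrite /hev horner_coef size_map_inj_poly ?mpolyC0 //; last first.
  by move=> x y /eqP; rewrite mpolyC_eq => /eqP.
by apply: eq_bigr => s _; rewrite coef_map_id0 ?mpolyC0 // mul_mpolyC.
Qed.

Lemma hevX f z k : hev (f ^+ k) z = hev f z ^+ k.
Proof. by rewrite /hev rmorphXn horner_exp. Qed.

Lemma msize_linf j v : (msize (linf (blockX j) v) <= 2)%N.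
Proof.
rewrite (leq_trans (msize_sum _ _ _)) //; apply/bigmax_leqP => l _.
by rewrite (leq_trans (msizeZ_le _ _)) // msizeX mdeg1.
Qed.

Lemma msize_hev (f : {poly R}) j v D : (size f <= D.+1)%N -> (msize (hev f (linf (blockX j) v)) <= D.+1)%N.
Proof.
move=> hf; rewrite hevE (leq_trans (msize_sum _ _ _)) //; apply/bigmax_leqP => s _.
rewrite (leq_trans (msizeZ_le _ _)) // (leq_trans (msize_exp_leq s (msize_linf j v))) // muln1.
by rewrite (leq_trans _ hf).
Qed.

(** Only the degree of the kernel enters D, not that of h: its power i contributes |x_j|^(i-k) h, of
    degree i, and vanishes unless i >= k with the same parity. *)
Lemma scong_funk_hecke N (I : finType) (W : I -> R) (u : I -> 'I_n -> R) k h (s : {poly R}) D j :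
  sphere_design N W u -> harmonic_homog k h -> (k + size s <= N)%N -> (size s <= D.+1)%N ->
  scong D (\sum_i (W i * h.@[u i]) *: hev s (linf (blockX j) (u i)))
    (mfun (scoef R n k) s *: block j h).
Proof.
case=> _ _ Du hh hN hD; under eq_bigr do rewrite hevE scaler_sumr.
rewrite exchange_big /mfun scaler_suml; apply: scong_sum => i _.
have -> : \sum_i0 (W i0 * h.@[u i0]) *: (s`_i *: linf (blockX j) (u i0) ^+ i) =
   (s`_i * scoef R n k i) *: (block j h * block j (sqX R n) ^+ ((i - k)./2)).
  under eq_bigr do rewrite scalerA mulrC -scalerA.
  rewrite -scaler_sumr (Du k i h _ (blockX j) hh); last by rewrite (leq_trans _ hN) // leq_add2l ltnW.
  have -> : sqx (blockX j) = block j (sqX R n).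
    rewrite /sqx /block raddf_sum; apply: eq_bigr => l _.
    by rewrite /= rmorphXn /= comp_mpolyXU -tnth_nth tnth_mktuple.
  by rewrite scalerA [block j h * _]mulrC.
rewrite -scalerA -[X in scong _ _ X]scalerA.
have [o|o] := boolP (odd (i + k)).
  by rewrite /scoef gcoef_odd // mul0r !scale0r scaler0; apply: scong_refl.
have [ik|ki] := ltnP i k.
  by rewrite /scoef gcoef_lt // mul0r !scale0r scaler0; apply: scong_refl.
rewrite -[X in scong _ _ (_ *: (_ *: X))]mulr1; do 2 apply: scong_scale.
have [h1 _ _] := scong_sqx j (i - k)./2.
apply: (@scong_leq (k + (i - k)./2 * 2)).
  rewrite muln2 halfK oddB // -oddD (negbTE o) subn0 subnKC //.
  by have := ltn_ord i; lia.
apply: scong_mul => //; rewrite (leq_trans (msize_block _ _)) // dhomog_msize_leq //.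
by case: hh.
Qed.
End FilteredCongruence.

(** * Components of q in products of spherical harmonics *)

Section BlockDecomposition.
Variables (R : realType) (m n d : nat).
Hypothesis n0 : (0 < n)%N.
Local Notation A := {mpoly R[m * n]}.

Definition mblock (a : 'X_{1..m * n}) (j : 'I_m) : 'X_{1..n} :=
  [multinom a (mxvec_index j l) | l < n].

Lemma big_mxvec_index (T : Type) (idx : T) (op : Monoid.com_law idx) (F : 'I_(m * n) -> T) :
  \big[op/idx]_i F i = \big[op/idx]_(j < m) \big[op/idx]_(l < n) F (mxvec_index j l).
Proof.
rewrite pair_bigA (reindex _ (curry_mxvec_bij m n)) /=.
by apply: eq_bigr => -[].
Qed.

Lemma mdeg_mblock a : (\sum_j mdeg (mblock a j) = mdeg a)%N.
Proof.
rewrite [RHS]mdegE big_mxvec_index; apply: eq_bigr => j _.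
by rewrite mdegE; apply: eq_bigr => l _; rewrite mnmE.
Qed.

Lemma mdeg_mblock_leq a j : (mdeg (mblock a j) <= mdeg a)%N.
Proof. by rewrite -mdeg_mblock (bigD1 j) //= leq_addr. Qed.

Lemma mpolyX_mblock a : 'X_[a] = \prod_j block j 'X_[mblock a j] :> A.
Proof.
rewrite mpolyXE_id big_mxvec_index; apply: eq_bigr => j _.
rewrite /block comp_mpolyX; apply: eq_bigr => l _.
by rewrite tnth_mktuple mnmE.
Qed.

(** A choice of harmonic components for every monomial; those of q are built from it by products
    over blocks and linearity. *)
Variable hh : 'X_{1..n} -> nat -> {mpoly R[n]}.
Hypothesis hhP : forall b, [/\ forall k, harmonic_homog k (hh b k),
  forall k, (mdeg b < k)%N -> hh b k = 0 &
  exists2 G, (msize G <= (mdeg b).-1)%N &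
    'X_[b] = \sum_(k < (mdeg b).+1) hh b k + (1 - sqX R n) * G].

Local Notation multi := {ffun 'I_m -> 'I_d.+1}.

Definition mterm a (q : multi) : A := \prod_j block j (hh (mblock a j) (q j)).

Lemma sum_hh b e : (mdeg b <= e)%N ->
  \sum_(k < e.+1) hh b k = \sum_(k < (mdeg b).+1) hh b k.
Proof.
move=> be; rewrite [RHS](big_ord_widen e.+1 (fun k => hh b k)) // big_mkcond [RHS]big_mkcond.
by apply: eq_bigr => k _; case: ltnP => //; case: (hhP b) => _ h _; apply: h.
Qed.

Lemma block_sphere_part (b : 'X_{1..n}) (j : 'I_m) e : (mdeg b <= e)%N ->
  scong (mdeg b) (block j 'X_[b]) (\sum_(k < e.+1) block j (hh b k)).
Proof.
move=> be; case: (hhP b) => _ _ [G sG eG].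
exists (fun i => if i == j then block j G else 0) => [i|].
  by case: eqP => _; rewrite ?msize0 // (leq_trans (msize_block _ _)).
rewrite [RHS](bigD1 j) //= eqxx [in RHS]big1 => [|i /negbTE ->]; last by rewrite mul0r.
rewrite addr0 -raddf_sum /= sum_hh // -raddfB /= eG [_ + (_ * G)]addrC addrK blockM linearB /=.
by rewrite block1 block_sqX; ring.
Qed.

Lemma msize_hh b k : (msize (hh b k) <= (mdeg b).+1)%N.
Proof.
case: (hhP b) => h1 h2 _; have [hk|hk] := ltnP (mdeg b) k; first by rewrite h2 // msize0.
by rewrite (leq_trans (dhomog_msize_leq (proj1 (h1 k)))).
Qed.

(** The other multidegrees have zero component by [mterm_high]; discarding them leaves at most
    binomial(d + m, m) terms instead of (d + 1)^m. *)
Definition low_deg : pred multi := fun q => (\sum_j q j <= d)%N.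

Lemma mterm_high a q : (mdeg a <= d)%N -> ~~ low_deg q -> mterm a q = 0.
Proof.
move=> ad hq; have [j hj] : exists j, (mdeg (mblock a j) < q j)%N.
  apply/existsP; apply: contraR hq; rewrite negb_exists => /forallP h.
  rewrite /low_deg (leq_trans _ ad) // -mdeg_mblock leq_sum // => j _.
  by rewrite leqNgt h.
rewrite /mterm (bigD1 j) //=; case: (hhP (mblock a j)) => _ -> // _.
by rewrite raddf0 mul0r.
Qed.

Lemma monomial_cong a : (mdeg a <= d)%N -> scong d 'X_[a] (\sum_(q | low_deg q) mterm a q).
Proof.
move=> ad; have -> : \sum_(q | low_deg q) mterm a q = \prod_j \sum_(k < d.+1) block j (hh (mblock a j) k).
  rewrite bigA_distr_bigA /= [RHS](bigID low_deg) /= [X in _ + X]big1 ?addr0 // => q hq.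
  exact: mterm_high.
have bd j : (mdeg (mblock a j) <= d)%N by rewrite (leq_trans (mdeg_mblock_leq a j)).
have H j : [/\ scong (mdeg (mblock a j)) (block j 'X_[mblock a j]) (\sum_(k < d.+1) block j (hh (mblock a j) k)),
   (msize (block j ('X_[mblock a j] : {mpoly R[n]})) <= (mdeg (mblock a j)).+1)%N &
   (msize (\sum_(k < d.+1) block j (hh (mblock a j) k))%R <= (mdeg (mblock a j)).+1)%N].
  split; first exact: block_sphere_part.
    by rewrite (leq_trans (msize_block _ _)) // msizeX.
  rewrite (leq_trans (msize_sum _ _ _)) //; apply/bigmax_leqP => k _.
  by rewrite (leq_trans (msize_block _ _)) // msize_hh.
rewrite mpolyX_mblock; have [h _ _] := scong_prod (index_enum 'I_m) xpredT H.
by apply: scong_leq h; rewrite mdeg_mblock.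
Qed.

Variable q : A.
Hypothesis dq : deg_le q d.

Definition mcomp (k : multi) : A := \sum_(a <- msupp q) q@_a *: mterm a k.

Lemma msupp_mdeg a : a \in msupp q -> (mdeg a <= d)%N.
Proof. by move=> /msize_mdeg_lt h; rewrite -ltnS (leq_trans h dq). Qed.

Lemma mcomp_cong : scong d q (\sum_(k | low_deg k) mcomp k).
Proof.
rewrite /mcomp exchange_big /= {1}[q]mpolyE big_seq [X in scong _ _ X]big_seq.
apply: scong_sum => a ha; rewrite -scaler_sumr; apply: scong_scale.
by apply: monomial_cong; apply: msupp_mdeg.
Qed.

Lemma evalX_mterm a k P : evalX (mterm a k) P = \prod_j (hh (mblock a j) (k j)).@[P j].
Proof. by rewrite /evalX rmorph_prod; apply: eq_bigr => j _; rewrite /= -evalX_block. Qed.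

(* The components of q are bounded by projecting one block of variables at a time. *)
Lemma mcomp_bound (B : R) k P : (forall P, @prod_spheres R m n P -> `|evalX q P| <= B) ->
  @prod_spheres R m n P -> `|evalX (mcomp k) P| <= gammaS R n d ^+ m * B.
Proof.
(* Blocks below s are already projected, the others still carry the monomial: [H 0] is q and [H m]
   is the component. *)
move=> qB; pose fac s a (P : 'M[R]_(m, n)) (j : 'I_m) : R :=
  if (j < s)%N then (hh (mblock a j) (k j)).@[P j] else 'X_[mblock a j].@[P j].
pose H s P := \sum_(a <- msupp q) q@_a * \prod_j fac s a P j.
have sph P' j : @prod_spheres R m n P' -> sphere (P' j).
  by move=> /(_ j) /eqP; rewrite subr_eq0 eq_sym => /eqP.
suff hH s P' : (s <= m)%N -> @prod_spheres R m n P' -> `|H s P'| <= gammaS R n d ^+ s * B.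
  move=> hP; have := hH m P (leqnn m) hP; congr (`|_| <= _).
  rewrite /evalX /mcomp raddf_sum; apply: eq_bigr => a _ /=.
  rewrite mevalZ -/(evalX _ P) evalX_mterm; congr (_ * _); apply: eq_bigr => j _.
  by rewrite /fac ltn_ord.
elim: s P' => [|s IH] P' sm hP'.
  rewrite expr0 mul1r (_ : H 0 P' = evalX q P') ?qB //.
  rewrite /evalX [q in RHS]mpolyE raddf_sum; apply: eq_bigr => a _ /=.
  rewrite mevalZ mpolyX_mblock rmorph_prod; congr (_ * _); apply: eq_bigr => j _ /=.
  by rewrite -/(evalX _ P') evalX_block.
pose j0 := Ordinal sm.
pose c a := q@_a * \prod_(j | j != j0) fac s a P' j.
(* With all blocks but j0 frozen at P', [H s] as a function of x_j0 is p, and [H s.+1] is its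
   component of degree [k j0]. *)
pose p : {mpoly R[n]} := \sum_(a <- msupp q) c a *: 'X_[mblock a j0].
pose pk l : {mpoly R[n]} := \sum_(a <- msupp q) c a *: hh (mblock a j0) l.
have dp : deg_le p d.
  rewrite /deg_le (leq_trans (msize_sum _ _ _)) //; apply/bigmax_leqP_seq => a ha _.
  rewrite (leq_trans (msizeZ_le _ _)) // msizeX ltnS (leq_trans (mdeg_mblock_leq a j0)) //.
  exact: msupp_mdeg.
have hpk l : (l <= d)%N -> harmonic_homog l (pk l).
  have hl b : harmonic_homog l (hh b l) by case: (hhP b).
  move=> _; split; first by apply: rpred_sum => a _; apply: rpredZ; case: (hl (mblock a j0)).
  by rewrite linear_sum big1 // => a _; rewrite linearZ /=; case: (hl (mblock a j0)) => _ ->; rewrite scaler0.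
have hp v : sphere v -> p.@[v] = \sum_(l < d.+1) (pk l).@[v].
  move=> vs; rewrite /pk; under eq_bigr do rewrite raddf_sum.
  rewrite exchange_big /p raddf_sum big_seq [RHS]big_seq; apply: eq_bigr => a ha /=.
  under eq_bigr do rewrite mevalZ; rewrite -mulr_sumr mevalZ; congr (_ * _).
  have bd : (mdeg (mblock a j0) <= d)%N by rewrite (leq_trans (mdeg_mblock_leq a j0)) // msupp_mdeg.
  case: (hhP (mblock a j0)) => _ _ [G _ ->].
  rewrite mevalD mevalM mevalB meval1 sqXE vs subrr mul0r addr0 -(sum_hh bd) raddf_sum.
  by [].
have -> : H s.+1 P' = (pk (k j0)).@[P' j0].
  rewrite /H /pk raddf_sum; apply: eq_bigr => a _ /=.
  rewrite mevalZ /c -mulrA [\prod_(j | j != j0) _ * _]mulrC (bigD1 j0) //= {1}/fac ltnSn.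
  congr (_ * (_ * _)); apply: eq_bigr => j jj0; rewrite /fac ltnS leq_eqVlt.
  by move: jj0; rewrite -val_eqE /= => /negbTE ->.
have kd : (k j0 <= d)%N by rewrite -ltnS.
apply: (le_trans (gammaS_bound n0 dp hpk hp kd (sph _ j0 hP'))).
rewrite exprS -mulrA ler_wpM2l ?gammaS_ge0 //; apply: sph_norm_le => // v vs.
(* Replacing row j0 by v stays on X, so the induction bound on [H s] bounds the norm of p. *)
pose P2 : 'M[R]_(m, n) := \matrix_(j, l) if j == j0 then v l else P' j l.
have P2j0 : P2 j0 =1 v by move=> l; rewrite mxE eqxx.
have P2j j : j != j0 -> P2 j =1 P' j by move=> /negbTE jj0 l; rewrite mxE jj0.
have hP2 : @prod_spheres R m n P2.
  move=> j; have [->|jj0] := eqVneq j j0.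
    by under eq_bigr do rewrite P2j0; rewrite vs subrr.
  by under eq_bigr do rewrite P2j //; apply: hP'.
have -> : p.@[v] = H s P2; last by apply: IH => //; apply: ltnW.
rewrite /H /p raddf_sum; apply: eq_bigr => a _ /=.
have f0 : fac s a P2 j0 = ('X_[mblock a j0] : {mpoly R[n]}).@[v] by rewrite /fac ltnn (meval_eq _ P2j0).
rewrite mevalZ /c -mulrA [\prod_(j | j != j0) _ * _]mulrC [in RHS](bigD1 j0) //= f0; congr (_ * (_ * _)); apply: eq_bigr => j jj0.
by rewrite /fac !(meval_eq _ (P2j j jj0)).
Qed.
End BlockDecomposition.

(** * The perturbed polynomial is a sum of squares *)

Section Multiplier.
Variable R : realType.

(** The Laplacian is the second derivative here, and Euler's identity applied twice turns its
    vanishing into h = 0. *)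
Lemma harmonic_dim1 k (h : {mpoly R[1]}) : (1 < k)%N -> harmonic_homog k h -> h = 0.
Proof.
case: k => [|[|k]] // _ [hk hl].
have e2 := euler_homog hk; rewrite big_ord1 in e2.
have e1 := euler_homog (dhomog_mderiv ord0 hk); rewrite big_ord1 /= in e1.
rewrite /laplacian big_ord1 in hl; rewrite hl mulr0 in e1.
have d0 : h^`M(ord0) = 0.
  by apply/eqP; have /eqP := esym e1; rewrite scaler_eq0 pnatr_eq0.
rewrite d0 mulr0 in e2.
by apply/eqP; have /eqP := esym e2; rewrite scaler_eq0 pnatr_eq0.
Qed.

(* On the two-point sphere S^0 there are no harmonics of degree k > 1: their multiplier is set to 1. *)
Lemma zonal_multiplier n t : (0 < n)%N -> (0 < t)%N -> exists (f : {poly R}) (lam : nat -> R),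
  [/\ (size f <= t.+1)%N, lam 0 = 1,
   forall k, 0 <= 1 - lam k <= k%:R ^+ 2 * (5%:R / 2%:R * n%:R ^+ 2 / t%:R ^+ 2) &
   forall k (h : {mpoly R[n]}), harmonic_homog k h -> mfun (scoef R n k) (f ^+ 2) *: h = lam k *: h].
Proof.
move=> n0 t0; have [f [sf f1 fe]] := zonal_density R n0 t0.
pose good k := (k <= 1)%N || (1 < n)%N.
exists f, (fun k => if good k then mfun (scoef R n k) (f ^+ 2) else 1); split=> //.
- move=> k; case: ifP => gk.
    have /andP[-> h2] := eigenvalue_bound n0 gk f1.
    by rewrite (le_trans h2) // ler_wpM2l // exprn_ge0.
  by rewrite subrr lexx !mulr_ge0 ?invr_ge0 ?exprn_ge0 ?ler0n.
- move=> k h hh; case: ifP => // /negbT; rewrite /good negb_or -!ltnNge => /andP[k1 n1].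
  have e : n = 1%N by apply/eqP; rewrite eqn_leq -ltnS n1 n0.
  by move: h hh; rewrite e => h hh; rewrite (harmonic_dim1 k1 hh) !scaler0.
Qed.

Lemma prod_ge_1_sum (I : Type) (r : seq I) (x : I -> R) : (forall i, 0 <= 1 - x i <= 1) ->
  0 <= \prod_(i <- r) x i <= 1 /\ 1 - \sum_(i <- r) (1 - x i) <= \prod_(i <- r) x i.
Proof.
move=> h; elim: r => [|i r [/andP[p0 p1] IH]]; first by rewrite !big_nil ler01 lexx subr0 lexx.
rewrite !big_cons; have /andP[h1 h2] := h i.
move: (\prod_(_ <- _) _) (\sum_(_ <- _) _) p0 p1 IH => p s p0 p1 IH; split; nra.
Qed.

Lemma sum_sqr_leq (I : Type) (r : seq I) (k : I -> nat) :
  (\sum_(i <- r) k i ^ 2 <= (\sum_(i <- r) k i) ^ 2)%N.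
Proof.
elim: r => [|i r IH]; first by rewrite !big_nil.
by rewrite !big_cons sqrnD (leq_trans (leq_add (leqnn _) IH)) // leq_addr.
Qed.

(** The losses 1 - lambda add up to at most e times sum k_j^2 <= (sum k_j)^2 <= d^2, with no factor
    m; so the product is at least 3/8, and 8/3 is the inverse of that. *)
Lemma inv_prod_multiplier m d (lam : nat -> R) (e : R) (k : {ffun 'I_m -> 'I_d.+1}) :
  (forall k, 0 <= 1 - lam k <= k%:R ^+ 2 * e) -> 0 <= e -> d%:R ^+ 2 * e <= 5%:R / 8%:R ->
  low_deg k -> \prod_j lam (k j) != 0 /\
  `|(\prod_j lam (k j))^-1 - 1| <= 8%:R / 3%:R * (d%:R ^+ 2 * e).
Proof.
move=> hl e0 de kd.
have h1 j : 0 <= 1 - lam (k j) <= 1.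
  have /andP[-> h] := hl (k j); apply: (le_trans h); apply: (@le_trans _ _ (d%:R ^+ 2 * e)); last lra.
  by rewrite ler_wpM2r // -!natrX ler_nat leq_exp2r // -ltnS.
have [/andP[p0 p1] ps] := prod_ge_1_sum (index_enum 'I_m) h1.
have hs : \sum_j (1 - lam (k j)) <= d%:R ^+ 2 * e.
  apply: (@le_trans _ _ (\sum_j (k j)%:R ^+ 2 * e)).
    by apply: ler_sum => j _; case/andP: (hl (k j)).
  rewrite -mulr_suml ler_wpM2r //.
  under eq_bigr do rewrite -natrX; rewrite -natr_sum -natrX ler_nat.
  by rewrite (leq_trans (sum_sqr_leq _ _)) // leq_exp2r.
move: (\prod_j _) (\sum_j _) p0 p1 ps hs => p s p0 p1 ps hs.
have pp : 3%:R / 8%:R <= p by lra.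
have p_gt0 : 0 < p by lra.
split; first by rewrite gt_eqF.
have -> : p^-1 - 1 = (1 - p) / p by field; rewrite gt_eqF.
rewrite ger0_norm ?divr_ge0 ?subr_ge0 // ler_pdivrMr //.
move: (d%:R ^+ 2 * e) de hs => D de hs; nra.
Qed.
End Multiplier.

Section PerturbedMembership.
Variables (R : realType) (m n d t : nat).
Hypotheses (n0 : (0 < n)%N) (t0 : (0 < t)%N) (dt : (d <= 2 * t)%N) (m0 : (0 < m)%N).
Local Notation A := {mpoly R[m * n]}.
Local Notation multi := {ffun 'I_m -> 'I_d.+1}.

(* With q^ the image of q under the inverse of the product kernel operator, q^ + B + eps is
   nonnegative on the product of spheres; applying the operator back, written as a finite sum by
   the spherical design, exhibits q + B + eps as a sum of squares modulo the ideal. *)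
Lemma perturbed_membership (f : {poly R}) (lam : nat -> R) (q : A) (B delta : R) :
  (size f <= t.+1)%N -> lam 0 = 1 ->
  (forall k (h : {mpoly R[n]}), harmonic_homog k h -> mfun (scoef R n k) (f ^+ 2) *: h = lam k *: h) ->
  (forall k : multi, low_deg k -> \prod_j lam (k j) != 0 /\ `|(\prod_j lam (k j))^-1 - 1| <= delta) ->
  deg_le q d -> (forall P, @prod_spheres R m n P -> `|evalX q P| <= B) ->
  @trunc_qmod R m n (m * t)
    (q + (B + (\sum_(k : multi | low_deg k) 1) * (delta * (gammaS R n d ^+ m * B)))%:MP).
Proof.
move=> sf lam0 hlam hdelta dq qB.
have bX (b : 'X_{1..n}) : ('X_[b] : {mpoly R[n]}) \is (mdeg b).-homog by rewrite dhomogX.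
have [hh hhP] := choice (fun b => harmonic_decomposition n0 (bX b)).
have [I [W [u Du]]] := @sphere_design_exists R n n0 (d + (t.*2).+1).
have [W0 us _] := Du.
set eps := _ * (delta * _).
pose lk (k : multi) : R := \prod_j lam (k j).
pose qhat (P : 'M[R]_(m, n)) : R := \sum_(k | low_deg k) (lk k)^-1 * evalX (mcomp hh q k) P.
pose pt (i : {ffun 'I_m -> I}) : 'M[R]_(m, n) := \matrix_(j, l) u (i j) l.
have ptE i j : pt i j =1 u (i j) by move=> l; rewrite mxE.
have ptX i : @prod_spheres R m n (pt i).
  by move=> j; under eq_bigr do rewrite ptE; rewrite (us (i j)) subrr.
have hq P : @prod_spheres R m n P -> 0 <= qhat P + (B + eps).
  move=> hP; have -> : qhat P = evalX q P + \sum_(k | low_deg k) ((lk k)^-1 - 1) * evalX (mcomp hh q k) P.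
    rewrite (scong_evalX (mcomp_cong hhP dq) hP) [evalX (\sum_(_ | _) _) _]/evalX raddf_sum -big_split /=.
    by apply: eq_bigr => k _; rewrite -/(evalX _ _); ring.
  have h1 : - B <= evalX q P by have := qB P hP; rewrite ler_norml => /andP[].
  have h2 : `|\sum_(k | low_deg k) ((lk k)^-1 - 1) * evalX (mcomp hh q k) P| <= eps.
    rewrite (le_trans (ler_norm_sum _ _ _)) // /eps mulr_suml ler_sum // => k kl.
    rewrite mul1r normrM; have [_ hd] := hdelta k kl.
    by rewrite ler_pM // mcomp_bound.
  by move: h2; rewrite ler_norml => /andP[h2 _]; lra.
pose F (i : {ffun 'I_m -> I}) : A := \prod_j hev f (linf (@blockX R m n j) (u (i j))).
pose cf (i : {ffun 'I_m -> I}) : R := (\prod_j W (i j)) * (qhat (pt i) + (B + eps)).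
have cf0 i : 0 <= cf i by rewrite mulr_ge0 ?hq ?prodr_ge0.
pose S : A := \sum_i cf i *: F i ^+ 2.
have sF i : (msize (F i) <= (m * t).+1)%N.
  have -> : (m * t = \sum_(j < m) t)%N by rewrite sum_nat_const card_ord.
  by apply: msize_prod_leq => j; apply: msize_hev.
have sf2 : (size (f ^+ 2)%R <= (2 * t).+1)%N.
  by rewrite expr2 (leq_trans (size_polyMleq _ _)) // -subn1 leq_subLR (leq_trans (leq_add sf sf)) //; lia.
have kerN k : (k <= d)%N -> (k + size (f ^+ 2)%R <= d + t.*2.+1)%N.
  by move=> kd; rewrite leq_add // -mul2n.
have KH j k h : (k <= d)%N -> harmonic_homog k h ->
   scong (2 * t) (\sum_i (W i * h.@[u i]) *: hev f (linf (@blockX R m n j) (u i)) ^+ 2) (lam k *: block j h).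
  move=> kd hk; rewrite -[lam k *: _]linearZ /= -(hlam k h hk) linearZ /=.
  under eq_bigr do rewrite -hevX.
  by apply: (scong_funk_hecke j Du) => //; apply: kerN.
(* The sum over tuples of design points factors over the spheres, and the degrees 2t add up to
   2mt. *)
have KHall (h : 'I_m -> {mpoly R[n]}) (k : 'I_m -> nat) : (forall j, (k j <= d)%N) ->
  (forall j, harmonic_homog (k j) (h j)) ->
  scong (2 * (m * t)) (\sum_(i : {ffun 'I_m -> I}) (\prod_j W (i j) * \prod_j (h j).@[u (i j)]) *: F i ^+ 2)
     ((\prod_j lam (k j)) *: \prod_j block j (h j)).
  move=> kd hk.
  have -> : \sum_(i : {ffun 'I_m -> I}) (\prod_j W (i j) * \prod_j (h j).@[u (i j)]) *: F i ^+ 2 =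
     \prod_j \sum_i (W i * (h j).@[u i]) *: hev f (linf (@blockX R m n j) (u i)) ^+ 2.
    rewrite bigA_distr_bigA; apply: eq_bigr => i _ /=.
    by rewrite scaler_prod /F -prodrXl -big_split.
  rewrite -scaler_prod.
  have H j : [/\ scong (2 * t) (\sum_i (W i * (h j).@[u i]) *: hev f (linf (@blockX R m n j) (u i)) ^+ 2)
      (lam (k j) *: block j (h j)),
    (msize (\sum_i (W i * (h j).@[u i]) *: hev f (linf (@blockX R m n j) (u i)) ^+ 2)%R <= (2 * t).+1)%N
   & (msize (lam (k j) *: block j (h j)) <= (2 * t).+1)%N].
    split; first exact: KH.
      rewrite (leq_trans (msize_sum _ _ _)) //; apply/bigmax_leqP => i _.
      by rewrite (leq_trans (msizeZ_le _ _)) // -hevX msize_hev.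
    rewrite (leq_trans (msizeZ_le _ _)) // (leq_trans (msize_block _ _)) //.
    by rewrite (leq_trans (dhomog_msize_leq (proj1 (hk j)))) // ltnS (leq_trans (kd j)).
  have [hc _ _] := scong_prod (index_enum 'I_m) xpredT H.
  by move: hc; rewrite sum_nat_const card_ord mulnCA.
have one : harmonic_homog 0 (1 : {mpoly R[n]}).
  by split; rewrite ?dhomog1 // (@laplacian_low _ _ 0) ?dhomog1.
have SC : scong (2 * (m * t)) S (q + (B + eps)%:MP).
  (* Expanding [qhat] at the design points and exchanging sums, S becomes the kernel operator
     applied to each component divided by its eigenvalue, plus its value on the constant. *)
  have -> : S = \sum_(k | low_deg k) (lk k)^-1 *: (\sum_(a <- msupp q) q@_a *:
      \sum_(i : {ffun 'I_m -> I}) (\prod_j W (i j) * \prod_j (hh (mblock a j) (k j)).@[u (i j)]) *: F i ^+ 2)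
     + (B + eps) *: \sum_(i : {ffun 'I_m -> I}) (\prod_j W (i j) * \prod_(j < m) (1 : {mpoly R[n]}).@[u (i j)]) *: F i ^+ 2.
    have ev k i : evalX (mcomp hh q k) (pt i) =
        \sum_(a <- msupp q) q@_a * \prod_j (hh (mblock a j) (k j)).@[u (i j)].
      rewrite /evalX /mcomp raddf_sum; apply: eq_bigr => a _ /=.
      rewrite mevalZ -/(evalX _ _) evalX_mterm; congr (_ * _); apply: eq_bigr => j _.
      exact: meval_eq.
    rewrite scaler_sumr; under [X in _ = X + _]eq_bigr => k _.
      under eq_bigr do rewrite scaler_sumr.
      rewrite exchange_big scaler_sumr /=; over.
    rewrite exchange_big -big_split /=; apply: eq_bigr => i _.
    under eq_bigr => k _ do under eq_bigr do rewrite scalerA.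
    under eq_bigr => k _ do rewrite -scaler_suml scalerA.
    rewrite -scaler_suml scalerA -scalerDl; congr (_ *: _).
    rewrite /cf mulrDr [X in _ = _ + X]mulrC; congr (_ + _ * _); last first.
      by rewrite [X in _ = _ * X]big1 ?mulr1 // => j _; rewrite meval1.
    rewrite /qhat mulr_sumr; apply: eq_bigr => k _; rewrite ev mulrCA mulr_sumr; congr (_ * _).
    by apply: eq_bigr => a _; rewrite mulrCA.
  apply: scong_add.
    apply: (@scong_trans _ _ _ _ (\sum_(k | low_deg k) mcomp hh q k)); last first.
      apply: scong_sym; apply: scong_leq (mcomp_cong hhP dq); rewrite (leq_trans dt) //.
      by rewrite leq_mul2l /= leq_pmull.
    apply: scong_sum => k kl; have [lk0 _] := hdelta k kl.
    rewrite -[mcomp _ _ _](scalerK lk0).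
    apply: scong_scale; rewrite /mcomp scaler_sumr; apply: scong_sum => a _.
    rewrite [X in scong _ _ X]scalerA mulrC -scalerA; apply: scong_scale.
    by apply: KHall => j; [rewrite -ltnS | case: (hhP (mblock a j))].
  have := KHall (fun=> 1) (fun=> 0%N) (fun=> isT) (fun=> one).
  rewrite [\prod_j lam _]big1 // scale1r [\prod_j block _ _]big1; last by move=> j _; rewrite block1.
  by move/(scong_scale (B + eps)); rewrite alg_mpolyC.
have [h hs eS] := SC.
exists S, (fun j => - h j); split.
- exists [seq Num.sqrt (cf i) *: F i | i <- index_enum {ffun 'I_m -> I}].
  rewrite big_map; apply: eq_bigr => i _.
  by rewrite exprZn sqr_sqrtr.
- rewrite /deg_le (leq_trans (msize_sum _ _ _)) //; apply/bigmax_leqP => i _.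
  by rewrite (leq_trans (msizeZ_le _ _)) // msize_exp_leq.
(* [msize] at most 2mt - 1 means degree at most 2mt - 2, since mt > 0. *)
- by move=> j; rewrite /deg_le msizeN (leq_trans (hs j)) //; lia.
- under eq_bigr do rewrite mulNr; rewrite sumrN -eS; ring.
Qed.
End PerturbedMembership.

(** * Counting, soundness and the final estimate *)

Lemma card_low_deg m d : (#|[set k : {ffun 'I_m -> 'I_d.+1} | low_deg k]| <= 'C(d + m, m))%N.
Proof.
rewrite [(d + m)%N]addnC -card_partial_ord_partitions.
pose tup (k : {ffun 'I_m -> 'I_d.+1}) := [tuple k j | j < m].
have ti : injective tup.
  by move=> k k' e; apply/ffunP => j; have := congr1 (fun s => tnth s j) e; rewrite !tnth_mktuple.
rewrite -(card_imset _ ti); apply: subset_leq_card; apply/fintype.subsetP => _ /imsetP[k kl ->].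
move: kl; rewrite !inE /low_deg big_map -[index_enum _]enumT.
by rewrite big_enum.
Qed.

(** Soundness of certificates; it bounds the set in [lbT] above by q_min, so that its supremum is
    not a default value. *)
Lemma trunc_qmod_ge0 (R : realType) (m n s : nat) (f : {mpoly R[m * n]}) P :
  @trunc_qmod R m n s f -> @prod_spheres R m n P -> 0 <= evalX f P.
Proof.
move=> [sigma [h [[l ->] _ _ ->]]] hP.
have <- : evalX (\sum_(g <- l) g ^+ 2) P = evalX (\sum_(g <- l) g ^+ 2 + \sum_j h j * @gsph R m n j) P.
  apply/esym; apply: (@scong_evalX _ _ _ (\max_j msize (h j)).+1%N) => //.
  exists h; last by rewrite addrC addKr.
  by move=> j; apply: (leq_bigmax (F := fun j => msize (h j))).
by rewrite /evalX raddf_sum sumr_ge0 // => g _; rewrite /= rmorphXn sqr_ge0.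
Qed.

Theorem theorem4 (R : realType) (m n d : nat) :
  (2 <= m)%N -> (1 <= n)%N -> (1 <= d)%N ->
  forall (q : {mpoly R[m * n]}), @deg_le R (m * n) q d ->
  forall qmin qmax : R,
    (exists2 P, @prod_spheres R m n P & @evalX R m n q P = qmin) ->
    (forall P, @prod_spheres R m n P -> qmin <= @evalX R m n q P) ->
    (exists2 P, @prod_spheres R m n P & @evalX R m n q P = qmax) ->
    (forall P, @prod_spheres R m n P -> @evalX R m n q P <= qmax) ->
  forall t : nat, 2%:R * n%:R * d%:R * Num.sqrt (d%:R : R) <= t%:R ->
    qmin - @lbT R m n q (m * t) <= @CX R n d m / t%:R ^+ 2 * (qmax - qmin).
Proof.
move=> m2 n1 d1 q dq qmin qmax [Pmin hPmin ePmin] qge [Pmax hPmax ePmax] qle t ht.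
have d1R : 1 <= d%:R :> R by rewrite ler1n.
have n1R : 1 <= n%:R :> R by rewrite ler1n.
have sq1 : 1 <= Num.sqrt (d%:R : R) by rewrite -[X in X <= _]sqrtr1 ler_sqrt ?ltr01 // (lt_le_trans ltr01).
have sqE : Num.sqrt (d%:R : R) ^+ 2 = d%:R by rewrite sqr_sqrtr.
have tR : 2%:R * d%:R <= t%:R :> R.
  apply: le_trans ht; have h1 : d%:R <= n%:R * d%:R :> R by rewrite ler_peMl.
  have h2 : n%:R * d%:R <= n%:R * d%:R * Num.sqrt d%:R :> R by rewrite ler_peMr // mulr_ge0.
  by rewrite -!mulrA ler_wpM2l // mulrA (le_trans h1).
have dt : (2 * d <= t)%N by rewrite -(ler_nat R) natrM.
have t0 : (0 < t)%N by move: dt d1; clear; lia.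
have dt2 : (d <= 2 * t)%N by move: dt; clear; lia.
have tR0 : 0 < t%:R :> R by rewrite ltr0n.
have t2 : 4%:R * n%:R ^+ 2 * d%:R ^+ 3 <= t%:R ^+ 2 :> R.
  apply: (@le_trans _ _ ((2%:R * n%:R * d%:R * Num.sqrt d%:R) ^+ 2)).
    by rewrite exprMn sqE le_eqVlt; apply/orP; left; apply/eqP; ring.
  by rewrite ler_sqr // nnegrE ?ler0n // !mulr_ge0 // sqrtr_ge0.
have t2pos : 0 < t%:R ^+ 2 :> R by rewrite exprn_gt0.
pose X : R := n%:R ^+ 2 * d%:R ^+ 2 / t%:R ^+ 2.
have X0 : 0 <= X by rewrite !mulr_ge0 ?invr_ge0 ?exprn_ge0.
(* The hypothesis on t squares to t^2 >= 4 n^2 d^3; with d >= 1 this yields the required d^2 e =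
   (5/2) X <= 5/8. *)
have X4 : X <= 1 / 4%:R.
  rewrite /X ler_pdivrMr // (@le_trans _ _ (n%:R ^+ 2 * d%:R ^+ 3)) //.
    apply: ler_wpM2l; first exact: exprn_ge0.
    by rewrite [leRHS]exprS; apply: ler_peMl => //; apply: exprn_ge0.
  by lra.
have [f [lam [sf lam0 lamle hlam]]] := zonal_multiplier R n1 t0.
have e0 : 0 <= 5%:R / 2%:R * n%:R ^+ 2 / t%:R ^+ 2 :> R by rewrite !mulr_ge0 ?invr_ge0 ?exprn_ge0 ?ler0n.
have deE : d%:R ^+ 2 * (5%:R / 2%:R * n%:R ^+ 2 / t%:R ^+ 2) = 5%:R / 2%:R * X by rewrite /X; ring.
have de : d%:R ^+ 2 * (5%:R / 2%:R * n%:R ^+ 2 / t%:R ^+ 2) <= 5%:R / 8%:R :> R by rewrite deE; lra.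
(* The leading 2 undoes the half in B. The bound dominates (8/3) (5/2) X because m 2^m >= 8. *)
pose delta : R := 2%:R * (m%:R * 2%:R ^+ m * n%:R ^+ 2 * d%:R ^+ 3 / t%:R ^+ 2).
have hdelta (k : {ffun 'I_m -> 'I_d.+1}) : low_deg k ->
   \prod_j lam (k j) != 0 /\ `|(\prod_j lam (k j))^-1 - 1| <= delta.
  move=> kl; have [h1 h2] := inv_prod_multiplier lamle e0 de kl.
  split=> //; apply: (le_trans h2); rewrite deE.
  have -> : delta = 2%:R * (m%:R * 2%:R ^+ m * d%:R) * X by rewrite /delta /X; ring.
  rewrite mulrA ler_wpM2r //.
  have h3 : 2%:R * 2%:R ^+ 2 <= m%:R * 2%:R ^+ m :> R.
    by rewrite -!natrX -!natrM ler_nat leq_mul // leq_exp2l.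
  have h4 : m%:R * 2%:R ^+ m <= m%:R * 2%:R ^+ m * d%:R :> R.
    by rewrite ler_peMr // mulr_ge0 // exprn_ge0.
  lra.
(* Centring q at the midpoint makes its sup norm on X half of its range. *)
pose c : R := (qmin + qmax) / 2%:R; pose B : R := (qmax - qmin) / 2%:R.
have qm : qmin <= qmax by rewrite -ePmin qle.
have qc P : evalX (q - c%:MP) P = evalX q P - c by rewrite /evalX mevalB mevalC.
have dqc : deg_le (q - c%:MP) d.
  rewrite /deg_le (leq_trans (msizeD_le _ _)) // geq_max dq msizeN msizeC.
  by case: (c != 0).
have qB P : @prod_spheres R m n P -> `|evalX (q - c%:MP) P| <= B.
  move=> hP; rewrite qc ler_norml; have := qge P hP; have := qle P hP.
  by rewrite /B /c; lra.
have := perturbed_membership n1 t0 dt2 (ltnW m2) sf lam0 hlam hdelta dqc qB.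
set eps := (\sum_(_ | _) 1) * _ => hmem.
have {hmem} hin : @trunc_qmod R m n (m * t) (q - (qmin - eps)%:MP).
  suff -> : q - (qmin - eps)%:MP = q - c%:MP + (B + eps)%:MP by [].
  by rewrite -addrA -mpolyCN -mpolyCN -mpolyCD; congr (_ + _%:MP); rewrite /B /c; field.
have lb : qmin - eps <= @lbT R m n q (m * t).
  apply: sup_upper_bound => //; split; first by exists (qmin - eps).
  exists qmin => tau htau; have := trunc_qmod_ge0 htau hPmin.
  by rewrite /evalX mevalB mevalC -/(evalX q Pmin) ePmin subr_ge0.
have card : \sum_(k : {ffun 'I_m -> 'I_d.+1} | low_deg k) 1 <= ('C(d + m, m))%:R :> R.
  by rewrite sumr_const ler_nat (leq_trans _ (card_low_deg m d)) // cardsE.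
have g0 : 0 <= gammaS R n d ^+ m by rewrite exprn_ge0 // gammaS_ge0.
have B0 : 0 <= B by rewrite /B divr_ge0 // subr_ge0.
have delta0 : 0 <= delta by rewrite /delta !mulr_ge0 ?invr_ge0 ?exprn_ge0.
apply: (@le_trans _ _ eps); first lra.
have -> : @CX R n d m / t%:R ^+ 2 * (qmax - qmin) =
    ('C(d + m, m))%:R * (delta * (gammaS R n d ^+ m * B)).
  by rewrite /CX /delta /B; field; rewrite gt_eqF.
by apply: ler_wpM2r card; apply: (mulr_ge0 delta0 (mulr_ge0 g0 B0)).
Qed.
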